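(* Let $p\in[1,+\infty)$, let $\Omega\subset\mathbb{R}^d$ be a bounded open set with Lipschitz boundary, and let $|\cdot|_*$ be a norm on $\mathbb{R}^d$. Let $K$ be a kernel on $\mathbb{R}^d$ such that: (i) there is $c_0\in(0,1]$ such that $|x|_*\le|y|_*$ implies $K(x)\ge c_0K(y)$; (ii) there are positive constants $D$ and $C_D$ such that $|y|_*=2|x|_*$ and $|x|_*\le D$ imply $K(x)\le C_DK(y)$; (iii) $\int_{\mathbb{R}^d}K(z)\min\{1,|z|_2^p\}\,dz<+\infty$. Then $W^{K,p}(\Omega)$ is continuously embedded in $W^{K,p}(\mathbb{R}^d)$ by extension; that is, there exists a positive constant $C=C(c_0,C_D,K,\Omega,|\cdot|_* )$ such that for every $u\in W^{K,p}(\Omega)$ there exists $\widetilde u\in W^{K,p}(\mathbb{R}^d)$ whose restriction to $\Omega$ equals $u$ and $$\|\widetilde u\|_{W^{K,p}(\mathbb{R}^d)}\le C\,\|u\|_{W^{K,p}(\Omega)}.$$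
   Context: Here $d\ge1$ and $|\cdot|_2$ is the Euclidean norm. A kernel is a measurable function $K:\mathbb{R}^d\to[0,+\infty]$ that is not a.e. equal to $0$. For an open set $\Omega\subset\mathbb{R}^d$ and $p\in[1,+\infty)$, $[u]_{W^{K,p}(\Omega)}:=\left(\int_{\Omega}\int_\Omega|u(x)-u(y)|^pK(x-y)\,dx\,dy\right)^{1/p}\in[0,+\infty]$, $W^{K,p}(\Omega):=\{u\in L^p(\Omega):[u]_{W^{K,p}(\Omega)}<+\infty\}$, and $\|u\|_{W^{K,p}(\Omega)}:=\|u\|_{L^p(\Omega)}+[u]_{W^{K,p}(\Omega)}$. *)

(* Defs.v *)
From HB Require Import structures.
From mathcomp Require Import all_boot all_order all_algebra.
From mathcomp Require Import all_classical all_reals all_analysis.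
From mathcomp Require Import measurable_realfun.
Set Implicit Arguments.
Unset Strict Implicit.
Unset Printing Implicit Defensive.
Import Order.TTheory GRing.Theory Num.Theory.
Import numFieldNormedType.Exports.
Local Open Scope classical_set_scope.
Local Open Scope ring_scope.

(* The space R^d with d >= 1 is 'rV[R]_n.+1, with n := d - 1; its topology is
   the one of MathComp-Analysis (induced by the sup norm). *)

Section lebesgue_outer.
Variables (R : realType) (n : nat).
Local Notation V := 'rV[R]_n.+1.

Definition box (I : V * V) : set V :=
  [set x | forall i, I.1 0 i < x 0 i <= I.2 0 i].

Definition box_volume (I : V * V) : \bar R :=
  (\prod_(i < n.+1) Num.max 0 (I.2 0 i - I.1 0 i))%:E.

Local Open Scope ereal_scope.

Definition box_cover (A : set V) : set (nat -> V * V) :=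
  [set F | A `<=` \bigcup_k box (F k)].

Definition lebesgue_outer (A : set V) : \bar R :=
  ereal_inf [set \sum_(k <oo) box_volume (F k) | F in box_cover A].

Lemma box_volume_ge0 I : 0 <= box_volume I.
Proof. by rewrite lee_fin; apply: prodr_ge0 => i _; rewrite le_max lexx. Qed.
Local Hint Resolve box_volume_ge0 : core.

Lemma lebesgue_outer_ge0 A : 0 <= lebesgue_outer A.
Proof.
by apply: le_ereal_inf_tmp => _ [F _ <-]; exact: nneseries_ge0.
Qed.

Lemma lebesgue_outer0 : lebesgue_outer set0 = 0.
Proof.
apply/eqP; rewrite eq_le lebesgue_outer_ge0 andbT.
apply: ereal_inf_lbound; exists (fun=> (0%R, 0%R)); first by [].
rewrite eseries0// => k _ _; rewrite /box_volume big_ord_recl/=.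
by rewrite subrr maxxx mul0r.
Qed.

Lemma le_lebesgue_outer : {homo lebesgue_outer : A B / A `<=` B >-> A <= B}.
Proof.
move=> A B AB; apply/ereal_inf_le_tmp => _ [F BF <-].
by exists F => //; exact: subset_trans AB BF.
Qed.

Lemma lebesgue_outer_sigma_subadditive : sigma_subadditive lebesgue_outer.
Proof.
move=> A; have [[i ioo]|] := pselect (exists i, lebesgue_outer (A i) = +oo).
  rewrite (eseries_pinfty _ _ ioo) ?leey// => k _.
  by rewrite -ltNye (lt_le_trans _ (lebesgue_outer_ge0 _)).
rewrite -forallNE => Aoo.
apply/lee_addgt0Pr => _/posnumP[e].
rewrite (le_trans _ (epsilon_trick _ _ _))//; last first.
  by move=> k; exact: lebesgue_outer_ge0.
pose P k (B : nat -> V * V) := box_cover (A k) B /\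
  \sum_(j <oo) box_volume (B j) <=
    lebesgue_outer (A k) + (e%:num / (2 ^ k.+1)%:R)%:E.
have [G PG] : {G : nat -> nat -> V * V & forall k, P k (G k)}.
  apply: (@choice _ _ P) => k.
  have en1 : (0 < e%:num / (2 ^ k.+1)%:R :> R)%R by [].
  have fA : lebesgue_outer (A k) \is a fin_num.
    by rewrite ge0_fin_numE ?lebesgue_outer_ge0// ltey; exact/eqP/Aoo.
  have [_ [B AB <-] /ltW muB] := lb_ereal_inf_adherent en1 fA.
  by exists B.
pose vol2 (x : nat * nat) := box_volume (G x.1 x.2).
apply: (@le_trans _ _ (\esum_(i in setT) vol2 i)).
  apply: ereal_inf_lbound => /=.
  have /card_esym/ppcard_eqP[f] := card_nat2.
  exists (fun k => G (f k).1 (f k).2).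
    move=> t [i _ /(PG i).1[j _ Bijt]]; exists (f^-1%FUN (i, j)) => //=.
    by rewrite invK ?inE.
  rewrite -(esum_pred_image vol2 _ xpredT) ?[fun=> _]set_true//; last first.
    by move=> *; exact: box_volume_ge0.
  by rewrite image_eq.
rewrite (_ : esum _ _ = \sum_(i <oo) \sum_(j <oo) vol2 (i, j)); last first.
  pose J : nat -> set (nat * nat) := fun i => [set (i, j) | j in setT].
  rewrite (_ : setT = \bigcup_k J k); last first.
    by rewrite predeqE => -[a b]; split => // _; exists a => //; exists b.
  rewrite esum_bigcupT /=; last 2 first.
    - apply/trivIsetP => i j _ _ ij.
      rewrite predeqE => -[k m] /=; split => //= -[] [_] _ [<-{k} _].
      by move=> [m' _] [] /esym/eqP; rewrite (negbTE ij).
    - by move=> /= [k m]; exact: box_volume_ge0.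
  rewrite -(image_id [set: nat]) -fun_true esum_pred_image//; last first.
    by move=> k _; apply: esum_ge0 => *; exact: box_volume_ge0.
  apply: eq_eseriesr => /= j _.
  rewrite -(esum_pred_image vol2 (pair j) predT)//=; last 2 first.
    by move=> *; exact: box_volume_ge0.
    by move=> ? ? _ _; exact: (@can_inj _ _ _ snd).
  by congr esum; rewrite predeqE => -[a b]; split; move=> [i _ <-]; exists i.
apply: lee_nneseries => k *; last exact: (PG k).2.
by apply: nneseries_ge0 => *; exact: box_volume_ge0.
Qed.

HB.instance Definition _ := isOuterMeasure.Build R V lebesgue_outer
  lebesgue_outer0 lebesgue_outer_ge0 le_lebesgue_outer
  lebesgue_outer_sigma_subadditive.

End lebesgue_outer.

(* The library has no Lebesgue measure on R^d: it is the Caratheodory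
   restriction of the outer measure above, so leb_space is
   'rV[R]_n.+1 with the sigma-algebra of all Lebesgue measurable sets: a
   function on it is measurable iff it is Lebesgue measurable. *)
Definition leb_space (R : realType) (n : nat) :=
  caratheodory_type (@lebesgue_outer R n).

HB.instance Definition _ (R : realType) (n : nat) :=
  Measurable.on (leb_space R n).

Definition leb (R : realType) (n : nat) : set (leb_space R n) -> \bar R :=
  @lebesgue_outer R n.

Arguments leb : clear implicits.

HB.instance Definition _ (R : realType) (n : nat) :=
  isMeasure.Build _ (leb_space R n) R (leb R n)
    (@caratheodory_measure0 R 'rV[R]_n.+1 (@lebesgue_outer R n))
    (@caratheodory_measure_ge0 R 'rV[R]_n.+1 (@lebesgue_outer R n))
    (@caratheodory_measure_sigma_additive R 'rV[R]_n.+1 (@lebesgue_outer R n)).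

Definition norm2 (R : realType) (m : nat) (x : 'rV[R]_m) : R :=
  Num.sqrt (\sum_(i < m) x 0 i ^+ 2).

Definition is_norm (R : realType) (m : nat) (N : 'rV[R]_m -> R) : Prop :=
  [/\ forall x y, N (x + y) <= N x + N y,
      forall a x, N (a *: x) = `|a| * N x &
      forall x, N x = 0 -> x = 0].

(* Near each boundary point, after an orthogonal change of coordinates (the
   matrix Q), Omega is the strict epigraph of a Lipschitz function of the first
   n coordinates. For n = 0 this says that Omega is locally a half-line. *)
Definition lipschitz_boundary (R : realType) (n : nat)
    (Omega : set 'rV[R]_n.+1) : Prop :=
  forall x0, (closure Omega `\` Omega°) x0 ->
  exists (r : R) (Q : 'M[R]_n.+1) (g : 'rV[R]_n -> R) (L : R),
    [/\ 0 < r, Q *m Q^T = 1%:M,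
        forall s t, `|g s - g t| <= L * norm2 (s - t) &
        forall x, norm2 (x - x0) < r ->
          (Omega x <-> g (col' ord_max (x *m Q)) < (x *m Q) 0 ord_max)].

Section WKp.
Variables (R : realType) (n : nat).
Local Notation V := 'rV[R]_n.+1.
Local Open Scope ereal_scope.

Definition is_kernel (K : V -> \bar R) : Prop :=
  [/\ forall x, 0 <= K x,
      measurable_fun [set: leb_space R n] (K : leb_space R n -> \bar R) &
      ~ {ae leb R n, forall x, K x = 0}].

(* Functions on Omega are represented by functions on the whole space whose
   values outside of Omega are irrelevant: u \_ Omega is 0 outside of Omega. *)
Definition Lp_norm (p : R) (Omega : set V) (u : V -> R) : \bar R :=
  'N[leb R n]_p%:E [EFin \o (u \_ Omega)].

Definition Lp_space (p : R) (Omega : set V) : set (V -> R) :=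
  [set u | measurable_fun (Omega : set (leb_space R n))
             (u : leb_space R n -> R) /\ Lp_norm p Omega u < +oo].

Definition WKp_seminorm (K : V -> \bar R) (p : R) (Omega : set V)
    (u : V -> R) : \bar R :=
  (\int[leb R n]_(y in Omega) \int[leb R n]_(x in Omega)
     ((`|u x - u y| `^ p)%:E * K ((x : V) - y)%R)) `^ p^-1.

Definition WKp_space (K : V -> \bar R) (p : R) (Omega : set V) : set (V -> R) :=
  [set u | Lp_space p Omega u /\ WKp_seminorm K p Omega u < +oo].

Definition WKp_norm (K : V -> \bar R) (p : R) (Omega : set V) (u : V -> R) :
    \bar R :=
  Lp_norm p Omega u + WKp_seminorm K p Omega u.

End WKp.

(* Main.v *)
(** Near a boundary point Omega is [{phi < 0}] for a Lipschitz function [phi]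
    with [phi (x + t nu) = phi x - t]; the fold [S x = x + 2 max(0, phi x) nu]
    is Lipschitz, is the identity on Omega, and maps a neighbourhood of the
    boundary point, minus a null set, into Omega.  If [eta] is a Lipschitz cutoff
    supported in that neighbourhood, then [eta * (u o S)] extends [eta * u] to the
    whole space with control of the energy: where [x - y] is small,
    [K (x - y) <= C K (S x - S y)] because [K] is almost radially decreasing and
    doubling near 0, and [S] pushes Lebesgue measure to at most a multiple of
    itself; everything else, including the variation of [eta], costs at most
    [|u|^p] convolved with the integrable function [K min(1, |z|)^p].  The local
    extensions are glued by [psi1 + (1 - psi1) psi2] along a finite cover of the
    closure of Omega.  Changes of variables are needed only as inequalities, so the
    crude bound [leb (f A) <= (6 L)^d leb A] for [L]-Lipschitz [f] suffices. *)
Require Import Defs.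
From HB Require Import structures.
From mathcomp Require Import all_boot all_order all_algebra.
From mathcomp Require Import all_classical all_reals all_analysis.
From mathcomp Require Import measurable_realfun.
From mathcomp Require Import ring lra.
Set Implicit Arguments.
Unset Strict Implicit.
Unset Printing Implicit Defensive.
Import Order.TTheory GRing.Theory Num.Theory.
Import numFieldNormedType.Exports.
Local Open Scope classical_set_scope.
Local Open Scope ring_scope.

(** * Lebesgue measurable sets *)

(** Measurability shapes most of the statements. The sigma-algebra of [leb_space] is the complete
    Lebesgue one, so [K (x - y)] need not be measurable for the product sigma-algebra, and a
    Lipschitz map need not pull measurable sets back to measurable sets. The first obstacle is met
    by a radial majorant [kappa] with K <= kappa <= K / c0, at the price of a factor 1 / c0 in the
    final estimate. The second is met because the fold is a bilipschitz involution on one side of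
    the graph and the identity on the other, and a bilipschitz map pulls null sets back to null
    sets. The null set to be discarded is the graph itself: the fold fixes it, and the open set
    Omega does not contain it. Estimates are written for p-th powers of norms, which makes them
    linear; roots are taken once, at the end. *)

Lemma lebesgue_outer_le_series (R : realType) (n : nat)
    (A : set 'rV[R]_n.+1) (F : nat -> 'rV[R]_n.+1 * 'rV[R]_n.+1) :
  A `<=` \bigcup_k box (F k) ->
  (lebesgue_outer A <= \sum_(k <oo) box_volume (F k))%E.
Proof. by move=> AF; apply: ereal_inf_lbound; exists F. Qed.

(** A hyperplane cuts a half-open box into two half-open boxes whose volumes add up exactly, so a
    cover of [X] splits into covers of its two parts with the same total volume. *)
Lemma caratheodory_halfspace (R : realType) (n : nat) (i : 'I_n.+1) (c : R) :
  (@lebesgue_outer R n).-caratheodory [set x | x 0 i <= c].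
Proof.
apply: (@le_caratheodory_measurable R 'rV[R]_n.+1 (@lebesgue_outer R n)) => X.
apply: le_ereal_inf_tmp => _ [F XF <-].
pose lo k : 'rV[R]_n.+1 :=
  \row_j if j == i then Num.max ((F k).1 0 j) c else (F k).1 0 j.
pose hi k : 'rV[R]_n.+1 :=
  \row_j if j == i then Num.min ((F k).2 0 j) c else (F k).2 0 j.
have -> : (\sum_(k <oo) box_volume (F k) =
    \sum_(k <oo) box_volume ((F k).1, hi k) +
    \sum_(k <oo) box_volume (lo k, (F k).2))%E.
  rewrite -nneseriesD; [|by move=> *; exact: box_volume_ge0..].
  apply: eq_eseriesr => k _; rewrite /box_volume -EFinD; congr EFin.
  rewrite (bigD1 i)//= [in RHS](bigD1 i)//= [X in _ = _ + X](bigD1 i)//=.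
  rewrite !mxE eqxx.
  under [X in _ = _ * X + _]eq_bigr => j ji do rewrite mxE (negbTE ji).
  under [X in _ = _ + _ * X]eq_bigr => j ji do rewrite mxE (negbTE ji).
  rewrite -mulrDl; congr (_ * _).
  (* What remains is max(0, b - a) = max(0, min(b, c) - a) + max(0, b - max(a, c)), valid for
     degenerate intervals too. *)
  set a := (F k).1 0 i; set b := (F k).2 0 i.
  rewrite /Num.max /Num.min.
  by repeat case: ifPn; rewrite -?leNgt => *; lra.
apply: leeD; apply: lebesgue_outer_le_series.
- move=> x [/XF[k _ xk] xc]; exists k => // j /=; have /andP[-> /=] := xk j.
  by rewrite mxE; case: eqP => // -> ; rewrite le_min xc andbT.
- move=> x [/XF[k _ xk] xc]; exists k => // j /=; have /andP[jl ->] := xk j.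
  rewrite andbT mxE; case: eqP => // ji; rewrite gt_max jl/= ji.
  by rewrite ltNge; apply/negP.
Qed.

Lemma measurable_coord (R : realType) (n : nat) (i : 'I_n.+1) :
  measurable_fun [set: leb_space R n] (fun x : leb_space R n => (x : 'rV[R]_n.+1) 0 i).
Proof.
apply: (measurability (@RGenOInfty.G R)) => [|_ [_ [c ->] <-]].
  exact: RGenOInfty.measurableE.
rewrite setTI.
have -> : (fun x : leb_space R n => (x : 'rV[R]_n.+1) 0 i) @^-1` `]c, +oo[%classic
    = ~` [set x : leb_space R n | (x : 'rV[R]_n.+1) 0 i <= c].
  by apply/seteqP; split=> x /=; rewrite in_itv/= andbT ltNge => /negP.
by apply: measurableC; exact: caratheodory_halfspace.
Qed.

Lemma ler_row_norm (R : realType) (n : nat) (x : 'rV[R]_n.+1) (r : R) :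
  `|x| <= r <-> forall i, `|x 0 i| <= r.
Proof.
rewrite [`|x|]/Num.norm/= mx_normrE; split=> [xr i|xr].
  by apply: le_trans xr; apply/bigmax_geP; right; exists (0, i).
apply/bigmax_leP; split => [|[j i] _]/=; last by rewrite ord1.
exact: le_trans (normr_ge0 _) (xr 0).
Qed.

Lemma ltr_row_norm (R : realType) (n : nat) (x : 'rV[R]_n.+1) (r : R) :
  `|x| < r <-> forall i, `|x 0 i| < r.
Proof.
rewrite [`|x|]/Num.norm/= mx_normrE; split=> [xr i|xr].
  by apply: le_lt_trans xr; apply/bigmax_geP; right; exists (0, i).
apply/bigmax_ltP; split => [|[j i] _]/=; last by rewrite ord1.
exact: le_lt_trans (normr_ge0 _) (xr 0).
Qed.

Lemma norm2_ge0 (R : realType) (m : nat) (x : 'rV[R]_m) : 0 <= norm2 x.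
Proof. exact: sqrtr_ge0. Qed.

Lemma ler_coord_norm2 (R : realType) (m : nat) (x : 'rV[R]_m) i : `|x 0 i| <= norm2 x.
Proof.
rewrite -sqrtr_sqr /norm2 ler_sqrt; last by apply: sumr_ge0 => j _; exact: sqr_ge0.
by rewrite (bigD1 i)//= lerDl; apply: sumr_ge0 => j _; exact: sqr_ge0.
Qed.

Lemma norm2_le_norm (R : realType) (n : nat) (x : 'rV[R]_n.+1) :
  norm2 x <= Num.sqrt n.+1%:R * `|x|.
Proof.
rewrite -[X in _ * X]ger0_norm// -sqrtr_sqr -sqrtrM// /norm2 ler_sqrt.
  rewrite -[X in X%:R * _]card_ord mulr_natl -sumr_const; apply: ler_sum => i _.
  have xi : `|x 0 i| <= `|x| by move: i; apply/ler_row_norm.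
  by rewrite -real_normK ?num_real// lerXn2r ?nnegrE.
by rewrite mulr_ge0// sqr_ge0.
Qed.

Lemma norm2_col' (R : realType) (n : nat) (x : 'rV[R]_n.+1) (j : 'I_n.+1) :
  norm2 (col' j x) <= norm2 x.
Proof.
rewrite /norm2 ler_sqrt; last by apply: sumr_ge0 => i _; exact: sqr_ge0.
rewrite [leRHS](bigD1_ord j)//= -[leLHS]add0r lerD ?sqr_ge0//.
by apply: ler_sum => i _; rewrite mxE.
Qed.

Lemma norm2_orthogonal (R : realType) (m : nat) (Q : 'M[R]_m) (x : 'rV[R]_m) :
  Q *m Q^T = 1%:M -> norm2 (x *m Q) = norm2 x.
Proof.
move=> QQ; rewrite /norm2.
have sumE (y : 'rV[R]_m) : \sum_i y 0 i ^+ 2 = (y *m y^T) 0 0.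
  by rewrite mxE; apply: eq_bigr => i _; rewrite mxE.
by rewrite !sumE trmx_mul mulmxA -(mulmxA x) QQ mulmx1.
Qed.

Lemma ler_norm_norm2 (R : realType) (n : nat) (x : 'rV[R]_n.+1) : `|x| <= norm2 x.
Proof. by apply/ler_row_norm => i; exact: ler_coord_norm2. Qed.

Lemma measurable_row_ball (R : realType) (n : nat) (a : 'rV[R]_n.+1) (r : R) :
  measurable ([set x | `|x - a| < r] : set (leb_space R n)).
Proof.
have -> : ([set x | `|x - a| < r] : set (leb_space R n)) =
    \bigcap_(i in [set: 'I_n.+1])
      ((fun x : leb_space R n => (x : 'rV[R]_n.+1) 0 i) @^-1` `]a 0 i - r, a 0 i + r[%classic).
  apply/seteqP; split=> x /=.
    by move/ltr_row_norm => H i _ /=; have := H i; rewrite !mxE in_itv/= ltr_distl.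
  by move=> H; apply/ltr_row_norm => i; have := H i Logic.I; rewrite !mxE/= in_itv/= ltr_distl.
apply: fin_bigcap_measurable => [|i _]; first exact: finite_finset.
by rewrite -[X in measurable X]setTI; exact: measurable_coord.
Qed.

Lemma rat_row_dense (R : realType) (n : nat) (x : 'rV[R]_n.+1) (e : R) :
  0 < e -> exists q : 'rV[rat]_n.+1, `|x - map_mx ratr q| < e.
Proof.
move=> e0.
have H i : exists q : rat, `|x 0 i - ratr q| < e.
  have [|q] := @rat_in_itvoo R (x 0 i - e) (x 0 i + e).
    by rewrite ltrBlDr -addrA ltrDl addr_gt0.
  by rewrite in_itv/= => qe; exists q; rewrite distrC ltr_distl.
have [f fe] := choice H.
by exists (\row_i f i); apply/ltr_row_norm => i; rewrite !mxE.
Qed.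

(** Each pair of the set lies in a product of two balls with rational centres and radius 1 / (k + 1)
    contained in the set, and there are countably many such products. This places the set in the
    product sigma-algebra itself, not merely in its completion. *)
Lemma open_preimage_sub_measurable (R : realType) (n : nat)
    (U : set 'rV[R]_n.+1) : open U ->
  measurable ([set z | U ((z.1 : 'rV[R]_n.+1) - z.2)] :
    set (leb_space R n * leb_space R n)).
Proof.
move=> oU.
pose B (q : 'rV[rat]_n.+1) (k : nat) : set (leb_space R n) :=
  [set x | `|x - map_mx ratr q| < k.+1%:R^-1].
pose F (i : 'rV[rat]_n.+1 * 'rV[rat]_n.+1 * nat) :=
  if `[< forall x y, B i.1.1 i.2 x -> B i.1.2 i.2 y -> U ((x : 'rV[R]_n.+1) - y) >]
  then B i.1.1 i.2 `*` B i.1.2 i.2 else set0.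
have -> : ([set z | U ((z.1 : 'rV[R]_n.+1) - z.2)] :
    set (leb_space R n * leb_space R n)) = \bigcup_i F i.
  apply/seteqP; split => [[x y]/= Uxy|[x y] [[[q q'] k] _]]; last first.
    by rewrite /F; case: asboolP => //= h [/= qx q'y]; exact: h.
  have /nbhs_ballP[e /= e0 eU] : nbhs ((x : 'rV[R]_n.+1) - y) U by exact: open_nbhs_nbhs.
  have [k ke] : exists k, k.+1%:R^-1 < e / 4.
    have e40 : 0 < e / 4 by rewrite divr_gt0.
    have := near_infty_natSinv_lt (PosNum e40).
    by case=> k _ /(_ k)/= h; exists k; apply: h => //=.
  have k0 : 0 < k.+1%:R^-1 :> R by [].
  have [q qx] := rat_row_dense x k0.
  have [q' qy] := rat_row_dense y k0.
  exists (q, q', k) => //; rewrite /F; case: asboolP => //= h; exfalso; apply: h.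
  move=> x' y' /=; rewrite /B /= => qx' qy'; apply: eU.
  rewrite -ball_normE/=.
  set a := map_mx ratr q in qx qx'; set b := map_mx ratr q' in qy qy'.
  (* The centres [a] and [b] split the difference into four terms, each below the common radius,
     hence the margin e / 4. *)
  have -> : (x : 'rV[R]_n.+1) - y - (x' - y') =
     (x - a) - (x' - a) - (y - b) + (y' - b).
    rewrite !opprB; set X := x : 'rV[R]_n.+1; set Y := y : 'rV[R]_n.+1.
    by apply/rowP => i; rewrite !mxE; ring.
  apply: (@lt_trans _ _ (k.+1%:R^-1 + k.+1%:R^-1 + k.+1%:R^-1 + k.+1%:R^-1)).
    apply: le_lt_trans (ler_normD _ _) _; apply: ltrD => //.
    apply: le_lt_trans (ler_normB _ _) _; apply: ltrD => //.
    by apply: le_lt_trans (ler_normB _ _) _; apply: ltrD.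
  by move: ke; set t := _^-1 => ke; lra.
apply: countable_bigcupT_measurable => [|i]; first exact: countableP.
rewrite /F; case: ifP => // _.
by apply: measurableX; exact: measurable_row_ball.
Qed.

(** [U] is the section at y = 0 of the set of pairs with x - y in [U]. *)
Lemma open_leb_measurable (R : realType) (n : nat) (U : set 'rV[R]_n.+1) :
  open U -> measurable (U : set (leb_space R n)).
Proof.
move=> oU.
have -> : (U : set (leb_space R n)) = ysection
   ([set z | U ((z.1 : 'rV[R]_n.+1) - z.2)] : set (leb_space R n * leb_space R n))
   (0 : 'rV[R]_n.+1).
  by apply/seteqP; split=> x; rewrite /ysection/= inE/= subr0.
by apply: measurable_ysection; exact: open_preimage_sub_measurable.
Qed.

Lemma continuous_leb_measurable (R : realType) (n : nat) (f : 'rV[R]_n.+1 -> R) :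
  continuous f -> measurable_fun [set: leb_space R n] (f : leb_space R n -> R).
Proof.
move=> cf; apply: (measurability (@RGenOInfty.G R)) => [|_ [_ [c ->] <-]].
  exact: RGenOInfty.measurableE.
rewrite setTI; apply: open_leb_measurable.
by apply: open_comp => [x _|]; [exact: cf | exact: interval_open].
Qed.

Lemma continuous_sub_measurable (R : realType) (n : nat) (f : 'rV[R]_n.+1 -> R) :
  continuous f -> measurable_fun [set: leb_space R n * leb_space R n]
    (fun z => f ((z.1 : 'rV[R]_n.+1) - z.2)).
Proof.
move=> cf; apply: (measurability (@RGenOInfty.G R)) => [|_ [_ [c ->] <-]].
  exact: RGenOInfty.measurableE.
rewrite setTI.
apply: (@open_preimage_sub_measurable R n (f @^-1` `]c, +oo[%classic)).
by apply: open_comp => [x _|]; [exact: cf | exact: interval_open].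
Qed.

Lemma leb_box_le (R : realType) (n : nat) (I : 'rV[R]_n.+1 * 'rV[R]_n.+1) :
  (lebesgue_outer (box I) <= box_volume I)%E.
Proof.
apply: le_trans (@lebesgue_outer_le_series R n _ (fun k => if k == 0 then I else (0, 0)) _) _.
  by move=> x Ix; exists 0.
rewrite (nneseriesD1 (n := 0))//; last by move=> *; exact: box_volume_ge0.
rewrite eseries0 ?adde0// => k _ /negbTE -> /=.
by rewrite /box_volume big_ord_recl/= subrr maxxx mul0r.
Qed.

Lemma leb_ball_lty (R : realType) (n : nat) (a : 'rV[R]_n.+1) (r : R) :
  (leb R n [set x | (`|x - a| < r)%R] < +oo)%E.
Proof.
apply: (@le_lt_trans _ _ (box_volume (a - const_mx r, a + const_mx r))); last by rewrite ltry.
apply: le_trans (leb_box_le _).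
apply: le_lebesgue_outer => x /= /ltr_row_norm H i; rewrite !mxE.
by have := H i; rewrite !mxE ltr_distl => /andP[-> /ltW ->].
Qed.

Lemma leb_sigma_finite (R : realType) (n : nat) :
  sigma_finite [set: leb_space R n] (leb R n).
Proof.
exists (fun k => [set x : 'rV[R]_n.+1 | `|x - 0| < k%:R]).
  apply/esym/seteqP; split => // x _.
  exists (Num.truncn `|x : 'rV[R]_n.+1|).+1 => //=.
  by rewrite subr0 truncnS_gt.
by move=> k; split; [exact: measurable_row_ball|exact: leb_ball_lty].
Qed.

HB.instance Definition _ (R : realType) (n : nat) :=
  Measure_isSigmaFinite.Build _ (leb_space R n) R (leb R n)
    (@leb_sigma_finite R n).

(** * Lipschitz and bilipschitz maps *)

Lemma lebesgue_outer_big (R : realType) (n : nat) (I : Type) (r : seq I)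
    (P : pred I) (A : I -> set 'rV[R]_n.+1) :
  (lebesgue_outer (\big[setU/set0]_(i <- r | P i) A i) <=
   \sum_(i <- r | P i) lebesgue_outer (A i))%E.
Proof.
elim/big_rec2 : _ => [|i y B _ IH]; first by rewrite lebesgue_outer0.
by apply: le_trans (outer_measureU2 _ _ _) _; exact: leeD.
Qed.

(** Cover the box by cubes whose side is its shortest side [s]: at most 2 l_i / s of them along an
    edge of length l_i. The image of a cube lies in a box of side 3 L s, and (3 L s)^d times the
    product of the 2 l_i / s is (6 L)^d times the volume. *)
Lemma lipschitz_image_box (R : realType) (n : nat)
    (f : 'rV[R]_n.+1 -> 'rV[R]_n.+1) (L : R)
    (I : 'rV[R]_n.+1 * 'rV[R]_n.+1) : 0 < L ->
  (forall x y, `|f x - f y| <= L * `|x - y|) ->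
  (lebesgue_outer (f @` box I) <= ((6 * L) ^+ n.+1)%:E * box_volume I)%E.
Proof.
move=> L0 fL; case: I => a b.
have CI0 : (0 <= ((6 * L) ^+ n.+1)%:E * box_volume (a, b))%E.
  by rewrite mule_ge0 ?box_volume_ge0// lee_fin exprn_ge0// mulr_ge0// ltW.
have [[i ba]|] := pselect (exists i, b 0 i <= a 0 i).
  suff -> : f @` box (a, b) = set0 by rewrite lebesgue_outer0.
  apply/seteqP; split=> // _ [x /(_ i)/= /andP[ax xb] _].
  by have := lt_le_trans ax (le_trans xb ba); rewrite ltxx.
move=> /forallNP H.
have l_gt0 i : 0 < b 0 i - a 0 i by rewrite subr_gt0 ltNge; apply/negP; exact: H.
pose s := \big[Num.min/(b 0 0 - a 0 0)]_i (b 0 i - a 0 i).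
have s0 : 0 < s by apply/bigmin_gtP; split.
have sl i : s <= b 0 i - a 0 i by exact: bigmin_le.
pose m i := (Num.truncn ((b 0 i - a 0 i) / s)).+1.
pose M := (\max_i m i)%N.
have mM i : (m i <= M)%N by exact: leq_bigmax.
(* Cubes are indexed by functions into the single type ['I_M]; [Q] cuts direction [i] down to its
   own count [m i]. *)
pose Q (i : 'I_n.+1) (j : 'I_M) := (j < m i)%N.
pose P (g : {ffun 'I_n.+1 -> 'I_M}) : set 'rV[R]_n.+1 :=
  [set x | forall i, a 0 i + s * (g i)%:R <= x 0 i <= a 0 i + s * (g i).+1%:R].
have cover : f @` box (a, b) `<=` \big[setU/set0]_(g in family Q) (f @` P g).
  move=> _ [x xab <-]; rewrite -bigcup_seq_cond/=.
  have xi i : (Num.truncn ((x 0%R i - a 0%R i) / s)%R < m i)%N.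
    rewrite ltnS truncn_le_nat; apply: le_lt_trans (truncnS_gt _).
    rewrite ler_pM2r ?invr_gt0// lerD2r.
    by have /andP[_ ] := xab i.
  pose g := [ffun i => Ordinal (leq_trans (xi i) (mM i))].
  exists g.
    by rewrite /= mem_index_enum/=; apply/familyP => i; rewrite ffunE; exact: xi.
  exists x => // i; rewrite ffunE/=.
  have xa : 0 <= (x 0 i - a 0 i) / s.
    by rewrite divr_ge0 ?(ltW s0)// subr_ge0 ltW//; have /andP[] := xab i.
  have /andP[t1 t2] := truncn_itv xa.
  have h1 : s * (Num.truncn ((x 0 i - a 0 i) / s))%:R <= x 0 i - a 0 i.
    by rewrite mulrC -ler_pdivlMr.
  have h2 : x 0 i - a 0 i <= s * (Num.truncn ((x 0 i - a 0 i) / s)).+1%:R.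
    by rewrite mulrC -ler_pdivrMr// ltW.
  by apply/andP; split; lra.
apply: le_trans (le_lebesgue_outer cover) _.
apply: le_trans (lebesgue_outer_big _ _ _) _.
have PL g : (lebesgue_outer (f @` P g) <= ((3 * L * s) ^+ n.+1)%:E)%E.
  have [[p0 Pp0]|] := pselect (P g !=set0); last first.
    move=> /set0P/negP/negPn/eqP ->; rewrite image_set0 lebesgue_outer0 lee_fin.
    by rewrite exprn_ge0// !mulr_ge0// ltW.
  (* Boxes are open on the left, so the lower corner is moved by 2 L s instead of L s; hence the
     side 3 L s. *)
  apply: (@le_trans _ _ (box_volume (f p0 - const_mx (2 * L * s), f p0 + const_mx (L * s)))).
    apply: le_trans (leb_box_le _); apply: le_lebesgue_outer => _ [x Px <-] i /=.
    rewrite !mxE.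
    have : `|f x - f p0| <= L * s.
      apply: le_trans (fL _ _) _; rewrite ler_pM2l//; apply/ler_row_norm => j.
      rewrite !mxE ler_distl; have /andP[] := Px j; have /andP[] := Pp0 j.
      rewrite -!natr1 !mulrDr !mulr1 !addrA => h1 h2 h3 h4.
      by apply/andP; split; lra.
    move/ler_row_norm => /(_ i); rewrite !mxE ler_distl => /andP[h1 h2].
    rewrite h2 andbT; apply: lt_le_trans h1.
    by rewrite ltrD2l ltrN2 -mulrA ltr_pMl ?mulr_gt0// ltrDl.
  rewrite lee_fin; rewrite -[X in _ ^+ X]card_ord -prodr_const.
  apply: ler_prod => i _; rewrite le_max lexx/= !mxE ge_max !mulr_ge0 ?(ltW s0) ?(ltW L0)//=.
  lra.
apply: le_trans (lee_sum _ (fun g _ => PL g)) _.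
rewrite -EFinM sumEFin lee_fin.
under eq_bigr => g _ do rewrite -[X in _ ^+ X]card_ord -prodr_const.
rewrite -(bigA_distr_big_dep _ (fun _ _ => 3 * L * s)) /=.
rewrite -[X in _ ^+ X]card_ord -prodr_const -big_split/=.
apply: ler_prod => i _.
rewrite (big_ord_narrow (mM i)) sumr_const card_ord -[_ *+ _]mulr_natr.
apply/andP; split.
  by rewrite !mulr_ge0// ltW.
rewrite max_r ?(ltW (l_gt0 i))//.
(* Because [s] is the shortest side, l_i / s >= 1, and so floor(l_i / s) + 1 <= 2 l_i / s. *)
have l1 : 1 <= (b 0 i - a 0 i) / s by rewrite ler_pdivlMr// mul1r.
have /andP[t1 _] := truncn_itv (le_trans ler01 l1).
rewrite /m -[X in _ * X]natr1.
have -> : 6 * L * (b 0 i - a 0 i) = 3 * L * s * (2 * ((b 0 i - a 0 i) / s)).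
  by field; rewrite gt_eqF.
rewrite ler_pM2l ?mulr_gt0//.
lra.
Qed.

Lemma lipschitz_image_outer (R : realType) (n : nat)
    (f : 'rV[R]_n.+1 -> 'rV[R]_n.+1) (L : R) (A : set 'rV[R]_n.+1) : 0 < L ->
  (forall x y, `|f x - f y| <= L * `|x - y|) ->
  (lebesgue_outer (f @` A) <= ((6 * L) ^+ n.+1)%:E * lebesgue_outer A)%E.
Proof.
move=> L0 fL.
have C0 : 0 < (6 * L) ^+ n.+1 by rewrite exprn_gt0// mulr_gt0.
rewrite -lee_pdivrMl//; apply: le_ereal_inf_tmp => _ [F AF <-].
rewrite lee_pdivrMl// -nneseriesZl; last by move=> k _; exact: box_volume_ge0.
apply: (@le_trans _ _ (\sum_(k <oo) lebesgue_outer (f @` box (F k)))%E).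
  apply: le_trans (lebesgue_outer_sigma_subadditive _).
  apply: le_lebesgue_outer => _ [x /AF[k _ xk] <-]; exists k => //.
apply: lee_nneseries => k *; first exact: lebesgue_outer_ge0.
exact: lipschitz_image_box.
Qed.

Lemma lipschitz_map_continuous (R : realType) (V W : normedModType R)
    (f : V -> W) (L : R) :
  (forall x y, `|f x - f y| <= L * `|x - y|) -> continuous f.
Proof.
move=> fL x; apply/cvgrPdist_lt => e e0.
have M0 : 0 < `|L| + 1 by rewrite ltr_pwDr.
near=> y; apply: le_lt_trans (fL _ _) _.
apply: (@le_lt_trans _ _ ((`|L| + 1) * `|x - y|)).
  by rewrite ler_wpM2r// (le_trans (ler_norm _))// lerDl.
rewrite mulrC -ltr_pdivlMr//; near: y.
apply/nbhs_ballP; exists (e / (`|L| + 1)); first by rewrite /= divr_gt0.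
by move=> y; rewrite -ball_normE.
Unshelve. all: by end_near. Qed.

(** Covers of [A] with excess 1 / (m + 1) define [G]; in the Caratheodory splitting of [G] by [A]
    the finite measure of [A] cancels and leaves 0 for the difference. This reduces preimages of
    measurable sets to preimages of boxes and of null sets. *)
Lemma measurable_Gdelta_hull (R : realType) (n : nat)
    (A : set (leb_space R n)) :
  measurable A -> (leb R n A < +oo)%E ->
  exists F : nat -> nat -> 'rV[R]_n.+1 * 'rV[R]_n.+1,
    let G := \bigcap_m \bigcup_k box (F m k) in
    A `<=` G /\ lebesgue_outer (G `\` A) = 0.
Proof.
move=> mA Aoo.
have Afin : lebesgue_outer A \is a fin_num.
  by rewrite ge0_fin_numE//; exact: lebesgue_outer_ge0.
have /choice[F FP] m : exists F, box_cover A F /\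
    (\sum_(k <oo) box_volume (F k) <= lebesgue_outer A + (m.+1%:R^-1)%:E)%E.
  have m0 : 0 < m.+1%:R^-1 :> R by [].
  by have [_ [B AB <-] /ltW muB] := lb_ereal_inf_adherent m0 Afin; exists B.
exists F => G; have AG : A `<=` G by move=> x Ax m _; exact: (FP m).1.
split=> //.
have GA : (lebesgue_outer G <= lebesgue_outer A)%E.
  apply/lee_addgt0Pr => e e0.
  have [m me] : exists m, m.+1%:R^-1 < e.
    have := near_infty_natSinv_lt (PosNum e0).
    by case=> k _ /(_ k)/= h; exists k; apply: h => //=.
  apply: le_trans (le_trans _ (FP m).2) _.
    by apply: lebesgue_outer_le_series => x; apply.
  by rewrite leeD2l// lee_fin ltW.
have := mA G; rewrite setIC (setIidl AG) => GE.
move: GA; rewrite GE -[X in (_ <= X)%E]adde0 leeD2lE// => GA0.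
apply/eqP; rewrite eq_le lebesgue_outer_ge0 andbT.
exact: GA0.
Qed.

Lemma lebesgue_null_measurable (R : realType) (n : nat) (A : set (leb_space R n)) :
  lebesgue_outer A = 0 -> measurable A.
Proof.
move=> A0; apply: (@le_caratheodory_measurable R 'rV[R]_n.+1 (@lebesgue_outer R n)) => X.
rewrite -[leRHS]add0e leeD//; last by apply: le_lebesgue_outer => x [].
by rewrite -A0; apply: le_lebesgue_outer => x [].
Qed.

Section bilipschitz.
Context (R : realType) (n : nat) (f g : 'rV[R]_n.+1 -> 'rV[R]_n.+1) (L L' : R).
Hypotheses (L_gt0 : 0 < L) (fg : cancel f g) (gf : cancel g f)
  (lip_f : forall x y, `|f x - f y| <= L' * `|x - y|)
  (lip_g : forall x y, `|g x - g y| <= L * `|x - y|).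

Lemma bilipschitz_preimage (A : set 'rV[R]_n.+1) : f @^-1` A = g @` A.
Proof.
apply/seteqP; split=> x; first by move=> Afx; exists (f x).
by move=> [y Ay <-] /=; rewrite gf.
Qed.

Lemma bilipschitz_preimage_le (A : set (leb_space R n)) :
  (leb R n (f @^-1` A) <= ((6 * L) ^+ n.+1)%:E * leb R n A)%E.
Proof. by rewrite bilipschitz_preimage; exact: lipschitz_image_outer. Qed.

(** Continuity settles preimages of boxes. Null sets are where the inverse enters: being Lipschitz,
    [g] sends them to null sets, which are measurable by completeness. *)
Lemma bilipschitz_measurable :
  measurable_fun [set: leb_space R n] (f : leb_space R n -> leb_space R n).
Proof.
have mbox I : measurable (f @^-1` box I : set (leb_space R n)).
  have -> : (f @^-1` box I : set (leb_space R n)) = \bigcap_(i in [set: 'I_n.+1])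
      ((fun x : leb_space R n => f x 0 i) @^-1` `]I.1 0 i, I.2 0 i]%classic).
    apply/seteqP; split=> x /= H i; [move=> _|]; first by rewrite /= in_itv/=.
    by have := H i Logic.I; rewrite /= in_itv.
  apply: fin_bigcap_measurable => [|i _]; first exact: finite_finset.
  rewrite -[X in measurable X]setTI.
  apply: (@continuous_leb_measurable R n (fun x => f x 0 i)) => //.
  apply: (@lipschitz_map_continuous _ _ _ _ L') => x y.
  by apply: le_trans (lip_f x y); have /ler_row_norm/(_ i) := lexx `|f x - f y|; rewrite !mxE.
have mfin (A : set (leb_space R n)) : measurable A -> (leb R n A < +oo)%E ->
    measurable (f @^-1` A : set (leb_space R n)).
  move=> mA Aoo; have [F [AG GA0]] := measurable_Gdelta_hull mA Aoo.
  set G := \bigcap_m _ in AG GA0.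
  have -> : f @^-1` A = f @^-1` G `\` f @^-1` (G `\` A).
    by apply: (@etrans _ _ (f @^-1` (G `\` (G `\` A)))) => //; rewrite setDD setIC (setIidl AG).
  apply: measurableD.
    rewrite /G preimage_bigcap; apply: bigcapT_measurable => m.
    rewrite preimage_bigcup; apply: bigcupT_measurable => k; exact: mbox.
  apply: lebesgue_null_measurable; apply/eqP.
  rewrite eq_le lebesgue_outer_ge0 andbT.
  by apply: le_trans (bilipschitz_preimage_le _) _; rewrite /leb GA0 mule0.
move=> _ A mA; rewrite setTI.
(* Intersecting with balls brings [A] down to sets of finite measure. *)
have -> : (f @^-1` A : set (leb_space R n)) =
    \bigcup_k (f @^-1` (A `&` [set x | `|x - 0| < k%:R])).
  apply/seteqP; split => [x Ax|x [k _ []//]].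
  exists (Num.truncn `|f x|).+1 => //=.
  by rewrite subr0 truncnS_gt.
apply: bigcupT_measurable => k; apply: mfin.
  by apply: measurableI => //; exact: measurable_row_ball.
apply: le_lt_trans (leb_ball_lty 0 k%:R).
by apply: le_lebesgue_outer => x [].
Qed.

End bilipschitz.

(** * Norms and radial majorants of kernels *)

(** The integral of a nonnegative function is a supremum over the simple functions below it, so the
    comparison is an inclusion of two families of simple functions. This is how integrals of
    [K (x - y)] are compared with integrals of measurable majorants and minorants. *)
Lemma le_integral_nonmeasurable d (T : measurableType d) (R : realType)
    (mu : {measure set T -> \bar R}) (D : set T) (f g : T -> \bar R) :
  (forall x, D x -> (0 <= f x)%E) -> (forall x, D x -> (f x <= g x)%E) ->
  (\int[mu]_(x in D) f x <= \int[mu]_(x in D) g x)%E.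
Proof.
move=> f0 fg.
rewrite !ge0_integralE//; last by move=> x Dx; exact: le_trans (f0 x Dx) (fg x Dx).
apply: ge_ereal_sup => _ [h hf <-]; apply: ereal_sup_ubound; exists h => // x.
apply: le_trans (hf x) _; rewrite /patch; case: ifPn => //; rewrite inE; exact: fg.
Qed.

Section norms.
Context (R : realType) (n : nat) (N : 'rV[R]_n.+1 -> R) (norm_N : is_norm N).

Lemma norm_at0 : N 0 = 0.
Proof. by have [_ NZ _] := norm_N; rewrite -(scale0r 0) NZ normr0 mul0r. Qed.

Lemma norm_opp x : N (- x) = N x.
Proof. by have [_ NZ _] := norm_N; rewrite -scaleN1r NZ normrN normr1 mul1r. Qed.

Lemma norm_nonneg x : 0 <= N x.
Proof.
have [ND _ _] := norm_N; have := ND x (- x).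
by rewrite subrr norm_at0 norm_opp -mulr2n pmulrn_lge0.
Qed.

Lemma norm_upper : exists b, 0 < b /\ forall x, N x <= b * `|x|.
Proof.
have [ND NZ _] := norm_N.
exists (\sum_(i < n.+1) N (delta_mx 0 i) + 1); split.
  by rewrite ltr_wpDl// sumr_ge0// => i _; exact: norm_nonneg.
move=> x; apply: (@le_trans _ _ ((\sum_(i < n.+1) N (delta_mx 0 i)) * `|x|)); last first.
  by rewrite ler_wpM2r// lerDl.
rewrite {1}(row_sum_delta x) mulr_suml.
elim/big_rec2 : _ => [|i r y _ IH]; first by rewrite norm_at0.
apply: le_trans (ND _ _) _; apply: lerD => //.
rewrite NZ mulrC ler_wpM2l ?norm_nonneg//.
by move: i {IH}; apply/ler_row_norm.
Qed.

Lemma norm_dist_le b : (forall x, N x <= b * `|x|) ->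
  forall x y, `|N x - N y| <= b * `|x - y|.
Proof.
have [ND _ _] := norm_N.
move=> Nb x y; rewrite ler_norml; apply/andP; split.
  rewrite lerNl opprB lerBlDr; apply: (@le_trans _ _ (N (y - x) + N x)).
    by apply: le_trans (ND _ _); rewrite subrK.
  by rewrite lerD2r distrC.
rewrite lerBlDr; apply: (@le_trans _ _ (N (x - y) + N y)).
  by apply: le_trans (ND _ _); rewrite subrK.
by rewrite lerD2r.
Qed.

Lemma is_norm_continuous : continuous N.
Proof.
have [b [_ Nb]] := norm_upper.
exact: (lipschitz_map_continuous (norm_dist_le Nb)).
Qed.

(** By compactness the continuous [N] attains a minimum on the unit sphere of the sup norm, positive
    since [N] vanishes only at 0; homogeneity does the rest. *)
Lemma norm_lower : exists a, 0 < a /\ forall x, a * `|x| <= N x.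
Proof.
have [_ NZ N0] := norm_N.
pose A : set 'rV[R]_n.+1 := [set x | `|x| = 1].
have cA : compact A.
  apply: bounded_closed_compact.
    by exists 1; split => // x x1 y; rewrite /A/= => ->; exact: ltW.
  rewrite (_ : A = (fun x : 'rV[R]_n.+1 => `|x|) @^-1` [set 1])//.
  by apply: closed_comp => [x _|]; [exact: norm_continuous | exact: closed_eq].
have A0 : A !=set0.
  exists (const_mx 1); rewrite /A/=; apply/eqP; rewrite eq_le; apply/andP; split.
    by apply/ler_row_norm => i; rewrite !mxE normr1.
  have /ler_row_norm/(_ 0) := lexx `|const_mx 1 : 'rV[R]_n.+1|.
  by rewrite mxE normr1.
have [c /set_mem c1 cmin] := EVT_min_rV A0 cA (continuous_subspaceT is_norm_continuous).
exists (N c); split.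
  rewrite lt_neqAle norm_nonneg andbT; apply/eqP => /esym/N0 c0.
  by move: c1; rewrite /A/= c0 normr0 => /eqP; rewrite eq_sym oner_eq0.
move=> x; have [->|x0] := eqVneq x 0; first by rewrite normr0 mulr0 norm_nonneg.
have nx0 : 0 < `|x| by rewrite normr_gt0.
have : N c <= N (`|x|^-1 *: x).
  by apply/cmin/mem_set; rewrite /A/= normrZ normfV normr_id mulVf ?gt_eqF.
by rewrite NZ normfV normr_id mulrC ler_pdivlMr.
Qed.

End norms.

(** The sup-norm counterpart of the Euclidean weight min(1, |z|_2^p), which bounds it from above. It
    is the p-th power of the function [rho] of [extension_piece]. *)
Definition trunc_pow (R : realType) (n : nat) (p : R) (z : 'rV[R]_n.+1) : R :=
  Num.min 1 `|z| `^ p.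

Section trunc_pow.
Context (R : realType) (n : nat).

Lemma trunc_pow_ge0 p (z : 'rV[R]_n.+1) : 0 <= trunc_pow p z.
Proof. exact: powR_ge0. Qed.

Lemma trunc_pow_measurable p :
  measurable_fun [set: leb_space R n] (@trunc_pow R n p : leb_space R n -> R).
Proof.
have mnorm := @continuous_leb_measurable R n _ (@norm_continuous _ 'rV[R]_n.+1).
have mmin : measurable_fun [set: leb_space R n]
    (fun z : leb_space R n => Num.min 1 `|z : 'rV[R]_n.+1| : R).
  by apply: measurable_minr => //; exact: mnorm.
exact: (measurableT_comp (measurable_powR p) mmin).
Qed.

End trunc_pow.

(* The nonincreasing radial majorant of [K]: replacing [K] by it makes the
   measurability of [K (x - y)] in the pair [(x, y)] available. *)
Definition radial_sup (R : realType) (n : nat) (N : 'rV[R]_n.+1 -> R)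
  (K : 'rV[R]_n.+1 -> \bar R) (r : R) : \bar R :=
  ereal_sup [set K y | y in [set y | r <= N y]].

Definition kernel_hull (R : realType) (n : nat) (N : 'rV[R]_n.+1 -> R)
  (K : 'rV[R]_n.+1 -> \bar R) (x : 'rV[R]_n.+1) : \bar R := radial_sup N K (N x).

Section kernel_hull.
Context (R : realType) (n : nat) (N : 'rV[R]_n.+1 -> R) (norm_N : is_norm N)
  (K : 'rV[R]_n.+1 -> \bar R) (K_ge0 : forall x, (0 <= K x)%E)
  (c0 : R) (c0_gt0 : 0 < c0)
  (K_decr : forall x y, N x <= N y -> (c0%:E * K y <= K x)%E).
Local Notation kappa := (kernel_hull N K).

Lemma radial_sup_nonincr r s : r <= s -> (radial_sup N K s <= radial_sup N K r)%E.
Proof.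
move=> rs; apply: ge_ereal_sup => _ [y /= sy <-]; apply: ereal_sup_ubound.
by exists y => //=; exact: le_trans sy.
Qed.

Lemma kernel_le_hull x : (K x <= kappa x)%E.
Proof. by apply: ereal_sup_ubound; exists x => /=. Qed.

Lemma kernel_hull_ge0 x : (0 <= kappa x)%E.
Proof. exact: le_trans (kernel_le_hull x). Qed.

Lemma kernel_hull_le x : (kappa x <= c0^-1%:E * K x)%E.
Proof.
apply: ge_ereal_sup => _ [y /= xy <-]; rewrite -[leLHS]mul1e.
by rewrite -(mulVf (lt0r_neq0 c0_gt0)) EFinM -muleA lee_wpmul2l ?K_decr// lee_fin invr_ge0 ltW.
Qed.

Lemma kernel_hull_opp x : kappa (- x) = kappa x.
Proof. by rewrite /kernel_hull norm_opp. Qed.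

(** The superlevel sets of a nonincreasing function on the line are intervals. *)
Lemma measurable_radial_sup : measurable_fun [set: R] (radial_sup N K).
Proof.
apply: (measurability (@ErealGenOInfty.G R)) => [|_ [_ [c ->] <-]].
  exact: ErealGenOInfty.measurableE.
rewrite setTI; apply: is_interval_measurable => x y /= xP yP z /andP[xz zy].
move: yP; rewrite /= !in_itv/= !andbT => /lt_le_trans; apply.
exact: radial_sup_nonincr.
Qed.

Lemma measurable_kernel_hull : measurable_fun [set: leb_space R n] (kappa : leb_space R n -> \bar R).
Proof.
apply: (measurableT_comp measurable_radial_sup).
exact: continuous_leb_measurable (is_norm_continuous norm_N).
Qed.

Lemma measurable_kernel_hull_sub : measurable_fun [set: leb_space R n * leb_space R n]
  (fun z => kappa ((z.1 : 'rV[R]_n.+1) - z.2)).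
Proof.
apply: (measurableT_comp measurable_radial_sup).
exact: continuous_sub_measurable (is_norm_continuous norm_N).
Qed.

(** Passing from [kappa] to [K] costs 1 / c0, doubling costs [CD], and the way back from [K] to
    [kappa] is free. *)
Lemma kernel_hull_doubling (CD D : R) :
  (forall x y, N y = 2 * N x -> N x <= D -> (K x <= CD%:E * K y)%E) ->
  0 < CD ->
  forall x, N x <= D -> (kappa x <= (CD / c0)%:E * kappa (2 *: x))%E.
Proof.
have [_ NZ _] := norm_N.
move=> Kdbl CD0 x xD; apply: le_trans (kernel_hull_le x) _.
rewrite [(CD / c0)%R]mulrC EFinM -muleA lee_wpmul2l ?lee_fin ?invr_ge0 ?(ltW c0_gt0)//.
apply: le_trans (Kdbl x (2 *: x) _ xD) _; first by rewrite NZ ger0_norm.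
by rewrite lee_wpmul2l ?lee_fin ?(ltW CD0)// kernel_le_hull.
Qed.

(** Enough doublings make [z] at least as long as [z'] for [N], and then the monotonicity of [kappa]
    concludes. Their number depends only on [L] and on the constants comparing [N] with the sup
    norm. *)
Lemma kernel_hull_comparable (CD D : R) : 0 < CD -> 0 < D ->
  (forall x y, N y = 2 * N x -> N x <= D -> (K x <= CD%:E * K y)%E) ->
  forall L, exists2 delta, 0 < delta & exists2 C, 0 < C &
  forall z z', `|z| < delta -> `|z'| <= L * `|z| ->
    (kappa z <= C%:E * kappa z')%E.
Proof.
move=> CD0 D0 Kdbl L.
have [a [a0 Na]] := norm_lower norm_N.
have [b [b0 Nb]] := norm_upper norm_N.
have [_ NZ _] := norm_N.
have A0 : 0 < CD / c0 by rewrite divr_gt0.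
have iter j : forall x, 2 ^+ j * N x <= D ->
    (kappa x <= ((CD / c0) ^+ j)%:E * kappa (2 ^+ j *: x))%E.
  elim: j => [|j IH] x; first by rewrite expr0 scale1r mul1e.
  move=> xD; have xD1 : 2 ^+ j * N x <= D.
    apply: le_trans xD; rewrite ler_wpM2r ?norm_nonneg// exprS.
    by rewrite ler_peMl ?exprn_ge0// ler1n.
  apply: le_trans (IH x xD1) _; rewrite exprSr EFinM -muleA lee_wpmul2l//.
    by rewrite lee_fin exprn_ge0// ltW.
  rewrite exprS -scalerA; apply: kernel_hull_doubling Kdbl CD0 _ _.
  by rewrite NZ ger0_norm ?exprn_ge0.
(* With 2^j >= b L / a one gets N z' <= b L |z| <= 2^j a |z| <= N (2^j z). *)
pose j := (Num.truncn (b * L / a)).+1.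
have jL : b * L / a <= 2 ^+ j.
  apply: ltW; apply: lt_le_trans (truncnS_gt _) _.
  by rewrite -natrX ler_nat ltnW// ltn_expl.
(* This radius gives 2^j N z <= D, so every intermediate point stays in the range where doubling
   holds. *)
exists (D / (2 ^+ j * b)); first by rewrite divr_gt0// mulr_gt0// exprn_gt0.
exists ((CD / c0) ^+ j); first by rewrite exprn_gt0.
move=> z z' zd z'z; apply: le_trans (iter j z _) _.
  apply: (@le_trans _ _ (2 ^+ j * (b * `|z|))).
    by rewrite ler_pM2l ?exprn_gt0.
  by rewrite mulrA mulrC -ler_pdivlMr ?ltW// mulr_gt0// exprn_gt0.
apply: lee_wpmul2l; first by rewrite lee_fin exprn_ge0// ltW.
apply: radial_sup_nonincr; rewrite NZ ger0_norm ?exprn_ge0//.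
apply: le_trans (Nb z') _.
apply: (@le_trans _ _ (b * (L * `|z|))); first by rewrite ler_pM2l.
apply: (@le_trans _ _ (2 ^+ j * (a * `|z|))); last by rewrite ler_pM2l ?exprn_gt0.
by rewrite !mulrA ler_wpM2r// -ler_pdivrMr.
Qed.

(** Pointwise c0 * kappa <= K, and the sup norm is below the Euclidean norm. *)
Lemma kernel_hull_integral_lty p : 1 <= p ->
  (\int[leb R n]_z (K z * (Num.min 1 (norm2 z `^ p))%:E) < +oo)%E ->
  (\int[leb R n]_z (kappa z * (trunc_pow p z)%:E) < +oo)%E.
Proof.
move=> p1 Koo; have p0 : 0 <= p by exact: le_trans ler01 p1.
have mq : measurable_fun [set: leb_space R n]
    (fun z : leb_space R n => (kappa z * (trunc_pow p z)%:E)%E).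
  apply: emeasurable_funM; first exact: measurable_kernel_hull.
  by apply/measurable_EFinP; exact: trunc_pow_measurable.
have q0 z : (0 <= kappa z * (trunc_pow p z)%:E)%E.
  by rewrite mule_ge0 ?kernel_hull_ge0// lee_fin trunc_pow_ge0.
have : (c0%:E * \int[leb R n]_z (kappa z * (trunc_pow p z)%:E) < +oo)%E.
  apply: le_lt_trans Koo; rewrite -ge0_integralZl//; last by rewrite lee_fin ltW.
  apply: le_integral_nonmeasurable => z _; first by rewrite mule_ge0// lee_fin ltW.
  rewrite muleA; apply: lee_pmul.
  - by rewrite mule_ge0 ?kernel_hull_ge0// lee_fin ltW.
  - by rewrite lee_fin trunc_pow_ge0.
  - rewrite -lee_pdivlMl//; exact: kernel_hull_le.
  - rewrite lee_fin le_min /trunc_pow; apply/andP; split.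
      apply: (@le_trans _ _ (1 `^ p)); last by rewrite powR1.
      by apply: ge0_ler_powR => //; rewrite ?nnegrE ?le_min ?ler01 ?normr_ge0// ?ge_min ?lexx.
    apply: ge0_ler_powR => //; rewrite ?nnegrE ?le_min ?ler01 ?normr_ge0//.
      exact: sqrtr_ge0.
    by rewrite ge_min ler_norm_norm2 orbT.
have [<-//|I0] := eqVneq 0%E (\int[leb R n]_z (kappa z * (trunc_pow p z)%:E))%E.
case: (integral _ _ _) => [r|//|//]; first by move=> _; rewrite ltry.
by rewrite gt0_muley// lte_fin.
Qed.

End kernel_hull.

(** * Energies on a measure space *)

Lemma powR_addr_le (R : realType) (p a b : R) : 0 <= p -> 0 <= a -> 0 <= b ->
  (a + b) `^ p <= 2 `^ p * (a `^ p + b `^ p).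
Proof.
move=> p0 a0 b0.
wlog ab : a b a0 b0 / a <= b.
  move=> H; have [/H|/ltW/H] := leP a b; first exact.
  by rewrite addrC [X in _ * X]addrC; exact.
apply: (@le_trans _ _ ((2 * b) `^ p)).
  apply: ge0_ler_powR => //; rewrite ?nnegrE ?addr_ge0 ?mulr_ge0//.
  by rewrite mulr_natl mulr2n lerD2r.
by rewrite powRM// ler_wpM2l ?powR_ge0// lerDr powR_ge0.
Qed.

(** The integrand of the p-th power of the seminorm, with the domain moved into indicators so that
    it lives on the whole product, where Tonelli applies. *)
Definition gagliardo d (T : measurableType d) (R : realType)
    (kap : T -> T -> \bar R) (p : R) (D : set T) (u : T -> R)
    (z : T * T) : \bar R :=
  ((\1_D z.1 * \1_D z.2 * `|u z.1 - u z.2| `^ p)%:E * kap z.1 z.2)%E.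

Definition Lp_mass d (T : measurableType d) (R : realType)
    (mu : {measure set T -> \bar R}) (p : R) (D : set T) (u : T -> R) : \bar R :=
  (\int[mu]_x (\1_D x * `|u x| `^ p)%:E)%E.

(** The p-th power of the norm in L^p plus that of the seminorm. *)
Definition energy d (T : measurableType d) (R : realType)
    (mu : {sigma_finite_measure set T -> \bar R}) (kap : T -> T -> \bar R)
    (p : R) (D : set T) (u : T -> R) : \bar R :=
  (Lp_mass mu p D u + \int[mu \x mu]_z gagliardo kap p D u z)%E.

(** The image of [mu] under [S] is a measure bounded by [M] times [mu]; integrate [h] against
    both. *)
Lemma quasi_preserving_integral_le d (T : measurableType d) (R : realType)
    (mu : {measure set T -> \bar R}) (S : T -> T) (M : R) (h : T -> \bar R) :
  0 < M -> measurable_fun setT S ->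
  (forall A, measurable A -> (mu (S @^-1` A) <= M%:E * mu A)%E) ->
  measurable_fun setT h -> (forall x, (0 <= h x)%E) ->
  (\int[mu]_x h (S x) <= M%:E * \int[mu]_x h x)%E.
Proof.
move=> M0 mS SM mh h0.
rewrite -[leLHS](@ge0_integral_pushforward _ _ _ _ R S mS mu setT h)//.
pose M' := NngNum (ltW M0).
rewrite -[leRHS](@ge0_integral_mscale _ _ _ mu setT measurableT M' h)//.
by apply: ge0_le_measure_integral.
Qed.

(** One half of a Schur test: Tonelli, then the bound on the integral of [q] over the other
    variable. *)
Lemma kernel_mass_fst_le d (T : measurableType d) (R : realType)
    (mu : {sigma_finite_measure set T -> \bar R}) (q : T -> T -> \bar R)
    (g : T -> \bar R) (Q : R) :
  (forall x y, (0 <= q x y)%E) -> measurable_fun [set: T * T] (fun z => q z.1 z.2) ->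
  0 <= Q -> (forall x, (\int[mu]_y q x y <= Q%:E)%E) ->
  (forall x, (0 <= g x)%E) -> measurable_fun setT g ->
  (\int[mu \x mu]_z (g z.1 * q z.1 z.2) <= Q%:E * \int[mu]_x g x)%E.
Proof.
move=> q0 mq Q0 qQ g0 mg.
pose f (z : T * T) := (g z.1 * q z.1 z.2)%E.
have mf : measurable_fun setT f.
  by apply: emeasurable_funM => //; exact: measurableT_comp.
have f0 z : (0 <= f z)%E by exact: mule_ge0.
rewrite (fubini_tonelli1 f mf f0) -ge0_integralZl//.
apply: le_integral_nonmeasurable => x _; first by apply: integral_ge0 => y _; exact: f0.
rewrite /fubini_F/f/= [leRHS]muleC.
have mqx : measurable_fun setT (q x) by exact: (measurable_fun_pair2 x mq).
by rewrite ge0_integralZl//; exact: lee_wpmul2l.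
Qed.

Lemma kernel_mass_snd_le d (T : measurableType d) (R : realType)
    (mu : {sigma_finite_measure set T -> \bar R}) (q : T -> T -> \bar R)
    (g : T -> \bar R) (Q : R) :
  (forall x y, (0 <= q x y)%E) -> measurable_fun [set: T * T] (fun z => q z.1 z.2) ->
  0 <= Q -> (forall y, (\int[mu]_x q x y <= Q%:E)%E) ->
  (forall x, (0 <= g x)%E) -> measurable_fun setT g ->
  (\int[mu \x mu]_z (g z.2 * q z.1 z.2) <= Q%:E * \int[mu]_x g x)%E.
Proof.
move=> q0 mq Q0 qQ g0 mg.
pose f (z : T * T) := (g z.2 * q z.1 z.2)%E.
have mf : measurable_fun setT f.
  by apply: emeasurable_funM => //; exact: measurableT_comp.
have f0 z : (0 <= f z)%E by exact: mule_ge0.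
rewrite (fubini_tonelli2 f mf f0) -ge0_integralZl//.
apply: le_integral_nonmeasurable => y _; first by apply: integral_ge0 => x _; exact: f0.
rewrite /fubini_G/f/= [leRHS]muleC.
have mqy : measurable_fun setT (q ^~ y) by exact: (measurable_fun_pair1 y mq).
by rewrite ge0_integralZl//; exact: lee_wpmul2l.
Qed.

(** * Transfer of energy along a map that almost preserves measure *)

Section energy_transfer.
Context d (T : measurableType d) (R : realType)
  (mu : {sigma_finite_measure set T -> \bar R}) (p : R) (p_ge1 : 1 <= p)
  (kap : T -> T -> \bar R) (kap_ge0 : forall x y, (0 <= kap x y)%E)
  (mkap : measurable_fun [set: T * T] (fun z => kap z.1 z.2))
  (rho : T -> T -> R) (rho_ge0 : forall x y, 0 <= rho x y)
  (mrho : measurable_fun [set: T * T] (fun z => rho z.1 z.2))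
  (Q : R) (Q_ge0 : 0 <= Q)
  (Q_right : forall x, (\int[mu]_y (kap x y * (rho x y `^ p)%:E) <= Q%:E)%E)
  (Q_left : forall y, (\int[mu]_x (kap x y * (rho x y `^ p)%:E) <= Q%:E)%E).

Let p_ge0 : 0 <= p. Proof. exact: le_trans ler01 p_ge1. Qed.
Let p_neq0 : p != 0. Proof. by rewrite gt_eqF// (lt_le_trans ltr01). Qed.

Let mindic1 (D : set T) : measurable D ->
  measurable_fun [set: T * T] (fun z => \1_D z.1 : R).
Proof. by move=> mD; exact: (measurableT_comp (measurable_indic mD) measurable_fst). Qed.

Let mindic2 (D : set T) : measurable D ->
  measurable_fun [set: T * T] (fun z => \1_D z.2 : R).
Proof. by move=> mD; exact: (measurableT_comp (measurable_indic mD) measurable_snd). Qed.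

Lemma measurable_gagliardo (D : set T) (u : T -> R) : measurable D ->
  measurable_fun setT u -> measurable_fun setT (gagliardo kap p D u).
Proof.
move=> mD um; apply: emeasurable_funM => //.
apply/measurable_EFinP; apply: measurable_funM.
  by apply: measurable_funM; [exact: mindic1|exact: mindic2].
apply: (measurableT_comp (measurable_powR _)) => //.
apply: measurableT_comp => //; apply: measurable_funB.
  exact: (measurableT_comp um).
exact: (measurableT_comp um).
Qed.

Lemma gagliardo_ge0 D u z : (0 <= gagliardo kap p D u z)%E.
Proof. by rewrite mule_ge0// lee_fin !mulr_ge0 ?powR_ge0. Qed.

Lemma Lp_mass_ge0 D (u : T -> R) : (0 <= Lp_mass mu p D u)%E.
Proof. by apply: integral_ge0 => x _; rewrite lee_fin mulr_ge0 ?powR_ge0. Qed.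

Lemma measurable_Lp_integrand (D : set T) (u : T -> R) : measurable D ->
  measurable_fun setT u ->
  measurable_fun [set: T] (fun x => (\1_D x * `|u x| `^ p)%:E).
Proof.
move=> mD um; apply/measurable_EFinP; apply: measurable_funM.
  exact: measurable_indic.
by apply: (measurableT_comp (measurable_powR _)) => //; exact: measurableT_comp.
Qed.


Section transfer.
Context (D B Gam : set T) (mD : measurable D) (mB : measurable B)
  (mGam : measurable Gam) (Gam0 : mu Gam = 0%E)
  (S : T -> T) (mS : measurable_fun setT S) (M : R) (M_gt0 : 0 < M)
  (SM : forall A, measurable A -> (mu (S @^-1` A) <= M%:E * mu A)%E)
  (SB : forall x, B x -> D (S x)) (d1 C1 : R) (d1_gt0 : 0 < d1)
  (C1_gt0 : 0 < C1)
  (kapS : forall x y, B x -> B y -> rho x y < d1 ->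
     (kap x y <= C1%:E * kap (S x) (S y))%E)
  (eta : T -> R) (meta : measurable_fun [set: T] (eta : T -> R))
  (eta01 : forall x, 0 <= eta x <= 1) (L1 : R)
  (L1_ge0 : 0 <= L1) (eta_dist : forall x y, `|eta x - eta y| <= L1 * rho x y)
  (eta0 : forall x, ~ B x -> ~ Gam x -> eta x = 0).

(** Set to 0 off [B], where [S] may leave [D]. The cutoff [eta] vanishes off [B] except on the null
    set [Gam]. *)
Definition pullback (u : T -> R) (x : T) : R := \1_B x * u (S x).

(** L1^p pays for the variation of [eta]; 2^p / d1^p pays for pairs with [rho x y >= d1], where the
    kernels at the points and at their images are not compared; the outer 2^p comes from splitting a
    sum. *)
Let A2 := 2 `^ p * (L1 `^ p + 2 `^ p / d1 `^ p).

Let twop : 1 <= 2 `^ p.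
Proof. by rewrite -[leLHS](powRr0 2) ler_powR// ler1n. Qed.

Lemma powR_dist_le (a b : R) : `|a - b| `^ p <= 2 `^ p * (`|a| `^ p + `|b| `^ p).
Proof.
apply: le_trans (powR_addr_le p_ge0 (normr_ge0 a) (normr_ge0 b)).
by apply: ge0_ler_powR; rewrite ?nnegrE ?addr_ge0// ler_normB.
Qed.

(** A product rule for [eta] times the pullback: the increment of the pullback is carried to
    [(S x, S y)] when the points are close, and all the rest is bounded by values of the pullback
    against [kap] times rho^p. *)
Lemma cutoff_pullback_pointwise (u : T -> R) (x y : T) :
  let w x := eta x * pullback u x in
  ~ Gam x -> ~ Gam y ->
  ((`|w x - w y| `^ p)%:E * kap x y <=
   (2 `^ p * C1)%:E * gagliardo kap p D u (S x, S y) +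
   (A2 * ((`|pullback u x| `^ p + `|pullback u y| `^ p) *
      rho x y `^ p))%:E * kap x y)%E.
Proof.
move=> w nGx nGy.
set k := kap x y; set t := rho x y `^ p.
set vx := `|pullback u x| `^ p; set vy := `|pullback u y| `^ p.
have k0 : (0 <= k)%E by exact: kap_ge0.
have t0 : 0 <= t by exact: powR_ge0.
have vx0 : 0 <= vx by exact: powR_ge0.
have vy0 : 0 <= vy by exact: powR_ge0.
have L1p : 0 <= L1 `^ p by exact: powR_ge0.
have d1p : 0 < d1 `^ p by exact: powR_gt0.
have G0 : (0 <= (2 `^ p * C1)%:E * gagliardo kap p D u (S x, S y))%E.
  by rewrite mule_ge0 ?gagliardo_ge0// lee_fin mulr_ge0 ?powR_ge0 ?ltW.
have etav (a b : T) (c : R) : (`|eta a - eta b| * `|c|) `^ p <=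
    L1 `^ p * (rho a b `^ p * `|c| `^ p).
  rewrite mulrA -powRM// -powRM ?mulr_ge0//.
  apply: ge0_ler_powR; rewrite ?nnegrE ?mulr_ge0//.
  by rewrite ler_wpM2r.
have A2_ge : L1 `^ p <= A2.
  rewrite /A2 mulrDr; apply: (@le_trans _ _ (2 `^ p * L1 `^ p)).
    by rewrite ler_peMl.
  by rewrite lerDl mulr_ge0 ?divr_ge0 ?powR_ge0.
have A20 : 0 <= A2 by exact: le_trans A2_ge.
(* Every case other than a close pair in [B] is absorbed by the second summand. *)
have reduce : `|w x - w y| `^ p <= A2 * ((vx + vy) * t) ->
    ((`|w x - w y| `^ p)%:E * k <= (2 `^ p * C1)%:E * gagliardo kap p D u (S x, S y) +
      (A2 * ((vx + vy) * t))%:E * k)%E.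
  move=> h; apply: (@le_trans _ _ ((A2 * ((vx + vy) * t))%:E * k)%E).
    by apply: lee_wpmul2r => //; rewrite lee_fin.
  by rewrite leeDr.
have [Bx|nBx] := pselect (B x); have [By|nBy] := pselect (B y).
- have wE : w x - w y = eta x * (pullback u x - pullback u y) +
      (eta x - eta y) * pullback u y by rewrite /w; ring.
  set dv := `|pullback u x - pullback u y| `^ p.
  have dv0 : 0 <= dv by exact: powR_ge0.
  have aB : `|w x - w y| `^ p <= 2 `^ p * (dv + L1 `^ p * (t * vy)).
    rewrite wE; apply: (@le_trans _ _ ((`|pullback u x - pullback u y| +
        `|eta x - eta y| * `|pullback u y|) `^ p)).
      apply: ge0_ler_powR; rewrite ?nnegrE ?addr_ge0 ?mulr_ge0//.
      apply: le_trans (ler_normD _ _) _; rewrite !normrM lerD2r.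
      have /andP[x0 x1] := eta01 x.
      by rewrite ger0_norm// ler_piMl.
    apply: le_trans (powR_addr_le _ _ _) _; rewrite ?mulr_ge0//.
    by rewrite ler_wpM2l ?powR_ge0// lerD2l; exact: etav.
  (* For far pairs, 1 <= rho^p / d1^p turns the crude bound on the increment into one with the
     weight rho^p. *)
  have [near|far] := ltP (rho x y) d1.
    apply: (@le_trans _ _ ((2 `^ p * (dv + L1 `^ p * (t * vy)))%:E * k)%E).
      by apply: lee_wpmul2r => //; rewrite lee_fin.
    rewrite mulrDr EFinD ge0_muleDl ?lee_fin ?mulr_ge0 ?powR_ge0//.
    apply: leeD.
      rewrite [in X in (X <= _)%E]EFinM [in X in (_ <= X)%E]EFinM -!muleA.
      apply: lee_wpmul2l; first by rewrite lee_fin powR_ge0.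
      rewrite /gagliardo/= !indicE !mem_set; [|exact: SB|exact: SB].
      rewrite !mul1r muleCA; apply: le_trans (lee_wpmul2l _ (kapS Bx By near)) _.
        by rewrite lee_fin.
      by rewrite /dv /pullback !indicE !mem_set// !mul1r.
    apply: lee_wpmul2r => //; rewrite lee_fin /A2 -mulrA.
    rewrite ler_wpM2l ?powR_ge0// mulrDl.
    apply: (@le_trans _ _ (L1 `^ p * ((vx + vy) * t))).
      by rewrite ler_wpM2l// mulrC ler_wpM2r// lerDr.
    by rewrite lerDl !mulr_ge0 ?invr_ge0 ?powR_ge0 ?addr_ge0.
  apply: reduce; apply: le_trans aB _; rewrite /A2 -mulrA.
  rewrite ler_wpM2l ?powR_ge0// mulrDl addrC; apply: lerD.
    by rewrite ler_wpM2l// mulrC ler_wpM2r// lerDr.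
  apply: le_trans (powR_dist_le _ _) _; rewrite -/vx -/vy -mulrA.
  rewrite ler_wpM2l ?powR_ge0// mulrCA ler_peMr ?addr_ge0//.
  rewrite mulrC ler_pdivlMr// mul1r /t.
  by apply: ge0_ler_powR; rewrite ?nnegrE ?(ltW d1_gt0).
(* With [eta y = 0] the increment is [(eta x - eta y) * pullback u x], small by the Lipschitz bound
   on [eta]. *)
- have Ey : eta y = 0 by exact: eta0.
  apply: reduce; rewrite /w Ey mul0r subr0.
  have -> : `|eta x * pullback u x| = `|eta x - eta y| * `|pullback u x|.
    by rewrite Ey subr0 normrM.
  apply: le_trans (etav _ _ _) _; rewrite -/t -/vx.
  apply: ler_pM => //; first by rewrite mulr_ge0.
  by rewrite mulrC ler_wpM2r// lerDl.
- have Ex : eta x = 0 by exact: eta0.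
  apply: reduce; rewrite /w Ex mul0r sub0r.
  have -> : `|- (eta y * pullback u y)| = `|eta x - eta y| * `|pullback u y|.
    by rewrite Ex sub0r !normrN normrM.
  apply: le_trans (etav _ _ _) _; rewrite -/t -/vy.
  apply: ler_pM => //; first by rewrite mulr_ge0.
  by rewrite mulrC ler_wpM2r// lerDr.
- have Ex : eta x = 0 by exact: eta0.
  have Ey : eta y = 0 by exact: eta0.
  apply: reduce; rewrite /w Ex Ey !mul0r subrr normr0 powR0//.
  by rewrite mulr_ge0// mulr_ge0 ?addr_ge0//.
Qed.

Lemma measurable_pullback (u : T -> R) : measurable_fun setT u ->
  measurable_fun setT (pullback u : T -> R).
Proof.
move=> um; apply: measurable_funM; first exact: measurable_indic.
exact: measurableT_comp.
Qed.

Lemma pullback_Lp_le (u : T -> R) : measurable_fun setT u ->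
  (\int[mu]_x (`|pullback u x| `^ p)%:E <= M%:E * Lp_mass mu p D u)%E.
Proof.
move=> um; apply: le_trans (quasi_preserving_integral_le M_gt0 mS SM _ _); last 2 first.
- exact: measurable_Lp_integrand.
- by move=> x; rewrite lee_fin mulr_ge0 ?powR_ge0.
apply: le_integral_nonmeasurable => x _; first by rewrite lee_fin powR_ge0.
rewrite lee_fin /pullback !indicE; have [Bx|nBx] := boolP (x \in B).
  by rewrite mem_set ?mul1r//; apply: SB; rewrite inE in Bx.
by rewrite mul0r normr0 powR0// mulr_ge0 ?powR_ge0.
Qed.

(** Tonelli lets [S] act on one variable at a time, each time at the cost of a factor [M]. *)
Lemma gagliardo_comp_le (u : T -> R) : measurable_fun setT u ->
  (\int[mu \x mu]_z gagliardo kap p D u (S z.1, S z.2) <=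
   (M * M)%:E * \int[mu \x mu]_z gagliardo kap p D u z)%E.
Proof.
move=> um; pose G := gagliardo kap p D u.
have mG : measurable_fun setT G by exact: measurable_gagliardo.
pose H (z : T * T) := G (S z.1, S z.2).
have mSS : measurable_fun [set: T * T] (fun z : T * T => (S z.1, S z.2)).
  by apply: measurable_fun_pair; exact: measurableT_comp.
have mH : measurable_fun setT H by exact: measurableT_comp.
have G0 z : (0 <= G z)%E by exact: gagliardo_ge0.
have H0 z : (0 <= H z)%E by exact: gagliardo_ge0.
rewrite -[leLHS]/(\int[mu \x mu]_z H z)%E -[X in (_ <= _ * X)%E]/(\int[mu \x mu]_z G z)%E.
rewrite (fubini_tonelli2 H mH H0) (fubini_tonelli2 G mG G0).
have mI := @measurable_fun_fubini_tonelli_G _ _ T T R (mu) G mG G0.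
have I0 y : (0 <= fubini_G (mu) G y)%E by apply: integral_ge0.
apply: (@le_trans _ _ (\int[mu]_y (M%:E * fubini_G (mu) G (S y)))%E).
  apply: le_integral_nonmeasurable => y _; first by apply: integral_ge0.
  rewrite /fubini_G/=.
  apply: (@quasi_preserving_integral_le _ _ _ mu S M (fun x => G (x, S y))) => //.
  exact: (measurableT_comp mG).
have mIS : measurable_fun setT (fun y => fubini_G mu G (S y)).
  exact: (measurableT_comp mI mS).
have M0 := ltW M_gt0.
rewrite (@ge0_integralZl _ _ _ mu setT measurableT _ mIS M%:E (fun y _ => I0 _) M0).
rewrite EFinM -muleA; apply: lee_wpmul2l => //.
exact: (quasi_preserving_integral_le M_gt0 mS SM mI I0).
Qed.

Lemma energy_pullback_le : exists C : R, 0 < C /\ forall u : T -> R,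
  measurable_fun setT u ->
  (energy mu kap p setT (fun x => eta x * pullback u x)%R <= C%:E * energy mu kap p D u)%E.
Proof.
pose q x y := (kap x y * (rho x y `^ p)%:E)%E.
have q0 x y : (0 <= q x y)%E by rewrite mule_ge0// lee_fin powR_ge0.
have mq : measurable_fun [set: T * T] (fun z => q z.1 z.2).
  apply: emeasurable_funM => //; apply/measurable_EFinP.
  exact: (measurableT_comp (measurable_powR _)).
pose A1 := 2 `^ p * C1.
have A10 : 0 <= A1 by rewrite mulr_ge0 ?powR_ge0// ltW.
have A20 : 0 <= A2.
  by rewrite /A2 mulr_ge0 ?addr_ge0 ?divr_ge0 ?powR_ge0.
have M0 := ltW M_gt0.
have A20' : (0 <= A2%:E)%E by rewrite lee_fin.
have B0 : 0 <= A1 * (M * M) := mulr_ge0 A10 (mulr_ge0 M0 M0).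
have D0 : 0 <= A2 * (Q * M) := mulr_ge0 A20 (mulr_ge0 Q_ge0 M0).
(* [M] bounds the mass, [A1 * (M * M)] the close pairs moved by [S] in both variables, and each
   [A2 * (Q * M)] the weighted pullback term of one variable. *)
exists (M + A1 * (M * M) + A2 * (Q * M) + A2 * (Q * M)); split.
  exact: ltr_wpDr D0 (ltr_wpDr D0 (ltr_wpDr B0 M_gt0)).
move=> u um; set w := fun x => _.
have mpu := measurable_pullback um.
have mw : measurable_fun setT (w : T -> R) by exact: measurable_funM.
pose g (x : T) := (`|pullback u x| `^ p)%:E.
have g0 x : (0 <= g x)%E by rewrite lee_fin powR_ge0.
have mg : measurable_fun [set: T] (g : T -> \bar R).
  apply/measurable_EFinP; apply: (measurableT_comp (measurable_powR _)) => //.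
  exact: measurableT_comp.
have gM := pullback_Lp_le um; rewrite -/g in gM.
have m0 := Lp_mass_ge0 D u.
have I0 : (0 <= \int[mu \x mu]_z gagliardo kap p D u z)%E.
  by apply: integral_ge0 => z _; exact: gagliardo_ge0.
have massw : (Lp_mass mu p setT w <= M%:E * Lp_mass mu p D u)%E.
  apply: le_trans gM; apply: le_integral_nonmeasurable => x _.
    by rewrite lee_fin mulr_ge0 ?powR_ge0.
  rewrite lee_fin indicT mul1r /w normrM; apply: ge0_ler_powR; rewrite ?nnegrE ?mulr_ge0//.
  by have /andP[e0 e1] := eta01 x; rewrite ger0_norm// ler_piMl.
pose F1 (z : T * T) := (A1%:E * gagliardo kap p D u (S z.1, S z.2))%E.
pose F2 (z : T * T) := (A2%:E * (g z.1 * q z.1 z.2))%E.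
pose F3 (z : T * T) := (A2%:E * (g z.2 * q z.1 z.2))%E.
have mSS : measurable_fun [set: T * T] (fun z : T * T => (S z.1, S z.2)).
  by apply: measurable_fun_pair; exact: measurableT_comp.
have mGS : measurable_fun setT (fun z : T * T => gagliardo kap p D u (S z.1, S z.2)).
  by apply: (measurableT_comp (measurable_gagliardo mD um)).
have mF1 : measurable_fun setT F1 by exact: emeasurable_funM.
have mgq1 : measurable_fun setT (fun z : T * T => g z.1 * q z.1 z.2)%E.
  by apply: emeasurable_funM => //; exact: (measurableT_comp mg).
have mgq2 : measurable_fun setT (fun z : T * T => g z.2 * q z.1 z.2)%E.
  by apply: emeasurable_funM => //; exact: (measurableT_comp mg).
have mF2 : measurable_fun setT F2 by exact: emeasurable_funM.
have mF3 : measurable_fun setT F3 by exact: emeasurable_funM.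
have F10 z : (0 <= F1 z)%E by rewrite mule_ge0 ?gagliardo_ge0.
have F20 z : (0 <= F2 z)%E by exact: (mule_ge0 _ (mule_ge0 (g0 _) (q0 _ _))).
have F30 z : (0 <= F3 z)%E by exact: (mule_ge0 _ (mule_ge0 (g0 _) (q0 _ _))).
have gagw : (\int[mu \x mu]_z gagliardo kap p setT w z <=
    \int[mu \x mu]_z (F1 z + F2 z + F3 z))%E.
  apply: ae_ge0_le_integral => //.
  - by move=> z _; exact: gagliardo_ge0.
  - exact: measurable_gagliardo.
  - by move=> z _; rewrite !adde_ge0.
  - by apply: emeasurable_funD => //; exact: emeasurable_funD.
  (* The pointwise bound can fail only when one of the two points lies in the null set [Gam]. *)
  exists ((Gam `*` setT) `|` (setT `*` Gam)); split.
  - by apply: measurableU; exact: measurableX.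
  - apply/eqP; rewrite eq_le measure_ge0 andbT.
    apply: (@le_trans _ _ ((mu \x mu) (Gam `*` setT) + (mu \x mu) (setT `*` Gam))%E).
      by apply: measureU2; exact: measurableX.
    rewrite !product_measure1E//.
    have -> : (mu Gam * mu setT = 0)%E by rewrite Gam0 mul0e.
    have -> : (mu setT * mu Gam = 0)%E by rewrite Gam0 mule0.
    by rewrite adde0.
  move=> [x y] /= nle; apply: contrapT => nG; apply: nle => _.
  have nGx : ~ Gam x by move=> Gx; apply: nG; left.
  have nGy : ~ Gam y by move=> Gy; apply: nG; right.
  rewrite {1}/gagliardo/= !indicT !mul1r.
  apply: le_trans (cutoff_pullback_pointwise u nGx nGy) _.
  rewrite -addeA leeD2l// /F2 /F3/= /q /g !muleA ![in leRHS](muleAC _ (kap _ _)).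
  have a1 c : 0 <= A2 * `|c| `^ p * rho x y `^ p.
    exact: mulr_ge0 (mulr_ge0 A20 (powR_ge0 _ _)) (powR_ge0 _ _).
  rewrite -!EFinM -ge0_muleDl ?lee_fin ?a1//.
  by rewrite -EFinD mulrDl mulrDr !mulrA.
rewrite /energy ge0_muleDr//.
apply: le_trans (leeD massw gagw) _.
rewrite ge0_integralD//; last 2 first.
- by move=> z _; rewrite adde_ge0.
- exact: emeasurable_funD.
rewrite ge0_integralD//.
rewrite ge0_integralZl//; last by move=> z _; exact: gagliardo_ge0.
rewrite ge0_integralZl//; last by move=> z _; rewrite mule_ge0.
rewrite ge0_integralZl//; last by move=> z _; rewrite mule_ge0.
have c1 := kernel_mass_fst_le q0 mq Q_ge0 Q_right g0 mg.
have c2 := kernel_mass_snd_le q0 mq Q_ge0 Q_left g0 mg.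
have cc : (Q%:E * \int[mu]_x g x <= (Q * M)%:E * Lp_mass mu p D u)%E.
  by rewrite EFinM -muleA; apply: lee_wpmul2l.
have gg := gagliardo_comp_le um.
apply: (@le_trans _ _ (M%:E * Lp_mass mu p D u +
   ((A1 * (M * M))%:E * \int[mu \x mu]_z gagliardo kap p D u z +
   (A2 * (Q * M))%:E * Lp_mass mu p D u + (A2 * (Q * M))%:E * Lp_mass mu p D u))%E).
  apply: leeD => //; apply: leeD; first apply: leeD.
  - by rewrite (EFinM A1) -(muleA A1%:E); apply: lee_wpmul2l.
  - by rewrite (EFinM A2) -(muleA A2%:E); apply: (lee_wpmul2l A20'); exact: le_trans c1 cc.
  - by rewrite (EFinM A2) -(muleA A2%:E); apply: (lee_wpmul2l A20'); exact: le_trans c2 cc.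
set mass := Lp_mass mu p D u; set J := integral _ _ _.
set c3 := A2 * (Q * M) in D0 *.
set c2' := A1 * (M * M) in B0 *.
rewrite [X in (X <= _)%E](_ : _ =
  (M + c3 + c3)%:E * mass + c2'%:E * J)%E; last first.
  rewrite !EFinD !ge0_muleDl ?lee_fin ?addr_ge0//.
  rewrite -!addeA; congr (_ + _)%E.
  by rewrite addeCA; congr (_ + _)%E; rewrite addeC.
apply: leeD; apply: lee_wpmul2r => //; rewrite lee_fin; clearbody c3 c2'; lra.
Qed.

End transfer.

End energy_transfer.

Lemma energy_add_le d (T : measurableType d) (R : realType)
    (mu : {sigma_finite_measure set T -> \bar R}) (kap : T -> T -> \bar R)
    (p : R) (D : set T) (u w : T -> R) : 1 <= p ->
  (forall x y, (0 <= kap x y)%E) ->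
  measurable_fun [set: T * T] (fun z => kap z.1 z.2) ->
  measurable D -> measurable_fun setT u -> measurable_fun setT w ->
  (energy mu kap p D (fun x => u x + w x)%R <=
   (2 `^ p)%:E * (energy mu kap p D u + energy mu kap p D w))%E.
Proof.
move=> p1 k0 mk mD um wm; have p0 : 0 <= p by exact: le_trans ler01 p1.
have powD (a b : R) : `|a + b| `^ p <= 2 `^ p * (`|a| `^ p + `|b| `^ p).
  apply: le_trans (powR_addr_le p0 (normr_ge0 a) (normr_ge0 b)).
  by apply: ge0_ler_powR; rewrite ?nnegrE ?addr_ge0// ler_normD.
have mug := measurable_gagliardo p mk mD um.
have mwg := measurable_gagliardo p mk mD wm.
have ug0 z := gagliardo_ge0 p k0 D u z.
have wg0 z := gagliardo_ge0 p k0 D w z.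
have mass : (Lp_mass mu p D (fun x => u x + w x)%R <=
    (2 `^ p)%:E * (Lp_mass mu p D u + Lp_mass mu p D w))%E.
  have mu1 := measurable_Lp_integrand p mD um.
  have mw1 := measurable_Lp_integrand p mD wm.
  have u0 (v : T -> R) x : (0 <= (\1_D x * `|v x| `^ p)%:E)%E.
    by rewrite lee_fin mulr_ge0 ?powR_ge0.
  rewrite /Lp_mass -(ge0_integralD _ measurableT (fun x _ => u0 u x) mu1 (fun x _ => u0 w x) mw1).
  rewrite -ge0_integralZl ?lee_fin ?powR_ge0//; last 2 first.
  - exact: emeasurable_funD.
  - by move=> x _; rewrite adde_ge0.
  apply: le_integral_nonmeasurable => x _; first exact: (u0 (fun x => u x + w x)).
  by rewrite -EFinD -EFinM lee_fin -mulrDr mulrCA ler_wpM2l.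
have gag : (\int[mu \x mu]_z gagliardo kap p D (fun x => u x + w x)%R z <=
    (2 `^ p)%:E * (\int[mu \x mu]_z gagliardo kap p D u z +
    \int[mu \x mu]_z gagliardo kap p D w z))%E.
  rewrite -(ge0_integralD _ measurableT (fun x _ => ug0 x) mug (fun x _ => wg0 x) mwg).
  rewrite -ge0_integralZl ?lee_fin ?powR_ge0//; last 2 first.
  - exact: emeasurable_funD.
  - by move=> x _; rewrite adde_ge0.
  apply: le_integral_nonmeasurable => z _; first exact: gagliardo_ge0.
  rewrite /gagliardo -ge0_muleDl ?lee_fin ?mulr_ge0 ?powR_ge0// -EFinD muleA -EFinM.
  apply: lee_wpmul2r => //; rewrite lee_fin -mulrDr mulrCA ler_wpM2l ?mulr_ge0//.
  by rewrite opprD addrACA.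
rewrite /energy; apply: le_trans (leeD mass gag) _.
rewrite -ge0_muleDr; [|by rewrite adde_ge0 ?Lp_mass_ge0|by rewrite adde_ge0 ?integral_ge0].
by rewrite addeACA.
Qed.

(** * Local extensions *)

Section extension_pieces.
Context (R : realType) (n : nat).
Local Notation V := 'rV[R]_n.+1.
Local Notation L := (leb_space R n).
Context (p : R) (p_ge1 : 1 <= p) (kappa : V -> \bar R)
  (kappa_ge0 : forall x, (0 <= kappa x)%E)
  (kappa_opp : forall x, kappa (- x) = kappa x)
  (mkappa : measurable_fun [set: L] (kappa : L -> \bar R))
  (mkappa_sub : measurable_fun [set: L * L] (fun z => kappa ((z.1 : V) - z.2)))
  (kappa_int : (\int[leb R n]_z (kappa z * (trunc_pow p z)%:E) < +oo)%E)
  (kappa_comparable : forall c : R, exists2 delta, 0 < delta & exists2 C, 0 < C &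
    forall z z' : V, `|z| < delta -> `|z'| <= c * `|z| ->
    (kappa z <= C%:E * kappa z')%E).

Let kap (x y : L) : \bar R := kappa ((x : V) - y)%R.

(** The map from y to x - y is an isometric involution; 6^d is the Lipschitz image bound at L =
    1. *)
Lemma translate_reflect_integral_le (q : V -> \bar R) (x : V) :
  (forall x, (0 <= q x)%E) -> measurable_fun [set: L] (q : L -> \bar R) ->
  (\int[leb R n]_y q (x - y)%R <= (6 ^+ n.+1)%:E * \int[leb R n]_y q y)%E.
Proof.
move=> q0 mq.
have lip1 y z : `|x - y - (x - z)| <= 1 * `|y - z|.
  by rewrite mul1r opprB addrC addrA subrK distrC.
have inv : cancel (fun y : V => x - y) (fun y : V => x - y) by exact: subKr.
have mS := bilipschitz_measurable ltr01 inv inv lip1 lip1.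
have SM (A : set L) : measurable A ->
    (leb R n ((fun y : V => x - y)%R @^-1` A) <= (6 ^+ n.+1)%:E * leb R n A)%E.
  move=> mA; rewrite -[X in (X ^+ _)%:E]mulr1.
  exact: (bilipschitz_preimage_le ltr01 inv inv lip1).
have c0 : 0 < 6 ^+ n.+1 :> R by rewrite exprn_gt0.
exact: (quasi_preserving_integral_le c0 mS SM mq q0).
Qed.

(** The choice rho = min(1, |x - y|) makes [kap] times rho^p an integrable function of x - y, so its
    integral in either variable is bounded uniformly in the other. *)
Lemma extension_piece (D B Gam : set L) (S : L -> L) (M c Le : R) (eta : V -> R) :
  measurable D -> measurable B -> measurable Gam -> leb R n Gam = 0%E ->
  measurable_fun setT S -> 0 < M ->
  (forall A, measurable A -> (leb R n (S @^-1` A) <= M%:E * leb R n A)%E) ->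
  (forall x, B x -> D (S x)) ->
  (forall x y : V, B x -> B y -> `|(S x : V) - S y| <= c * `|x - y|) ->
  (forall x, 0 <= eta x <= 1) ->
  (forall x y, `|eta x - eta y| <= Le * `|x - y|) ->
  (forall x, ~ B x -> ~ Gam x -> eta x = 0) ->
  exists C : R, 0 < C /\ forall u : L -> R, measurable_fun setT u ->
  measurable_fun setT (fun x : L => eta x * pullback B S u x) /\
  (energy (leb R n) kap p setT (fun x => eta x * pullback B S u x)%R <=
    C%:E * energy (leb R n) kap p D u)%E.
Proof.
move=> mD mB mG G0 mS M0 SM SB Slip eta01 eta_lip eta0.
have meta : measurable_fun [set: L] (eta : L -> R).
  apply: continuous_leb_measurable; exact: (lipschitz_map_continuous eta_lip).
pose rho (x y : L) : R := Num.min 1 `|(x : V) - y|.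
have rho_ge0 x y : 0 <= rho x y by rewrite le_min ler01/=.
have mrho : measurable_fun [set: L * L] (fun z => rho z.1 z.2).
  apply: measurable_minr => //.
  by apply: (@continuous_sub_measurable R n (fun x => `|x|)); exact: norm_continuous.
pose q (z : V) := (kappa z * (trunc_pow p z)%:E)%E.
have q0 z : (0 <= q z)%E by rewrite mule_ge0// lee_fin trunc_pow_ge0.
have mq : measurable_fun [set: L] (q : L -> \bar R).
  apply: (emeasurable_funM mkappa); apply/measurable_EFinP; exact: trunc_pow_measurable.
have QE : (\int[leb R n]_x q x = (fine (\int[leb R n]_x q x))%:E)%E.
  by rewrite fineK// ge0_fin_numE//; apply: integral_ge0.
pose Q := 6 ^+ n.+1 * fine (\int[leb R n]_x q x).
have Q0 : 0 <= Q.
  by rewrite mulr_ge0 ?exprn_ge0//; apply: fine_ge0; apply: integral_ge0.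
have Qr (x : L) : (\int[leb R n]_y (kap x y * (rho x y `^ p)%:E) <= Q%:E)%E.
  by rewrite /Q EFinM -QE; exact: (translate_reflect_integral_le x q0 mq).
(* The second bound follows from the first since [kappa] is even. *)
have Ql (y : L) : (\int[leb R n]_x (kap x y * (rho x y `^ p)%:E) <= Q%:E)%E.
  apply: le_trans (Qr y); apply: le_integral_nonmeasurable => x _; first exact: q0.
  by rewrite /rho /kap -opprB kappa_opp normrN.
have [delta delta0 [C1 C10 Ccomp]] := kappa_comparable c.
(* Below 1, [rho] is the distance itself, so the radius of comparability is capped there. *)
have d10 : 0 < Num.min 1 delta by rewrite lt_min ltr01.
have kS x y : B x -> B y -> rho x y < Num.min 1 delta ->
    (kap x y <= C1%:E * kap (S x) (S y))%E.
  move=> Bx By; rewrite /rho lt_min !gt_min => /andP[]; rewrite ltxx/= => xy1.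
  move=> xyd; apply: Ccomp; last exact: Slip.
  by case/orP: xyd => // d1; exact: lt_trans xy1 d1.
(* Increments of [eta] are at most 1 and at most Le |x - y|, hence at most max(1, Le) min(1, |x -
   y|). *)
have L10 : 0 <= Num.max 1 Le by rewrite le_max ler01.
have edist x y : `|eta x - eta y| <= Num.max 1 Le * rho x y.
  have /andP[x0 x1] := eta01 x; have /andP[y0 y1] := eta01 y.
  have e1 : `|eta x - eta y| <= 1 by rewrite ler_norml; apply/andP; split; lra.
  rewrite minr_pMr// le_min mulr1 le_max e1/=.
  by apply: le_trans (eta_lip x y) _; rewrite ler_wpM2r// le_max lexx orbT.
have [C [C0 HC]] := @energy_pullback_le _ L R (leb R n) p p_ge1 kap (fun x y => kappa_ge0 _)
  mkappa_sub rho rho_ge0 mrho Q Q0 Qr Ql D B Gam mD mB mG G0 S mS M M0 SM SB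
  _ C1 d10 C10 kS eta meta eta01 _ L10 edist eta0.
exists C; split; first exact: C0.
move=> u um; split; first exact: (measurable_funM meta (measurable_pullback mB mS um)).
exact: (HC u um).
Qed.

End extension_pieces.

(** * Cutoffs and null graphs *)

Definition tent (R : realType) (n : nat) (x0 : 'rV[R]_n.+1) (r : R)
  (x : 'rV[R]_n.+1) : R := Num.max 0 (Num.min 1 (2 - `|x - x0| / r)).

Section tent.
Context (R : realType) (n : nat) (x0 : 'rV[R]_n.+1) (r : R) (r_gt0 : 0 < r).

Lemma tent_itv x : 0 <= tent x0 r x <= 1.
Proof. by rewrite /tent le_max lexx/= ge_max ler01 ge_min lexx. Qed.

Lemma tent_eq1 x : `|x - x0| <= r -> tent x0 r x = 1.
Proof.
move=> xr; rewrite /tent min_l ?max_r//.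
by rewrite -lerBlDr opprK addrC -lerBrDr ler_pdivrMr//; lra.
Qed.

Lemma tent_eq0 x : 2 * r <= `|x - x0| -> tent x0 r x = 0.
Proof.
move=> xr; rewrite /tent max_l// ge_min; apply/orP; right.
by rewrite subr_le0 ler_pdivlMr.
Qed.

Lemma tent_lipschitz x y : `|tent x0 r x - tent x0 r y| <= r^-1 * `|x - y|.
Proof.
have clamp (a b : R) : `|Num.max 0 (Num.min 1 a) - Num.max 0 (Num.min 1 b)| <= `|a - b|.
  have : b - a <= `|a - b| by rewrite distrC ler_norm.
  have : a - b <= `|a - b| by exact: ler_norm.
  move: `|a - b| => t.
  rewrite ler_norml /Num.max /Num.min => h1 h2.
  by repeat case: ifPn; rewrite -?leNgt => *; apply/andP; split; lra.
apply: le_trans (clamp _ _) _.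
have -> : 2 - `|x - x0| / r - (2 - `|y - x0| / r) =
  r^-1 * (`|y - x0| - `|x - x0|) by ring.
rewrite normrM ger0_norm ?invr_ge0 ?(ltW r_gt0)// ler_pM2l ?invr_gt0//.
apply: le_trans (ler_dist_dist _ _) _.
by rewrite opprB addrA subrK distrC.
Qed.

End tent.

Section null_graph.
Context (R : realType) (n : nat) (phi : 'rV[R]_n.+1 -> R) (nu : 'rV[R]_n.+1) (c : R)
  (phi_lip : forall x y, `|phi x - phi y| <= c * `|x - y|)
  (phi_shift : forall x t, phi (x + t *: nu) = phi x - t).
Local Notation L := (leb_space R n).

Lemma measurable_graph_fun : measurable_fun [set: L] (phi : L -> R).
Proof. exact: continuous_leb_measurable (lipschitz_map_continuous phi_lip). Qed.

(* Infinitely many disjoint translates of the graph lie in a bounded set. *)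
Lemma graph_null (x0 : 'rV[R]_n.+1) (r : R) :
  leb R n [set x | phi x = 0 /\ `|x - x0| < r] = 0%E.
Proof.
pose t k : R := k.+1%:R^-1.
have t01 k : 0 < t k <= 1 by rewrite /t invr_gt0 ltr0n/= invf_le1 ?ler1n ?ltr0n.
pose tr k (x : 'rV[R]_n.+1) := x + t k *: nu.
pose itr k (x : 'rV[R]_n.+1) := x - t k *: nu.
(* [G k] is the graph piece moved by [t k *: nu]. The levels - t k are distinct, which makes these
   sets disjoint, and t k <= 1 keeps them within r + |nu| of [x0]. *)
pose G k : set L := [set x | phi x = - t k] `&` [set x | `|x - (x0 + t k *: nu)| < r].
have mG k : measurable (G k).
  apply: measurableI; last exact: measurable_row_ball.
  rewrite -[X in measurable X]setTI.
  exact: (measurable_graph_fun measurableT (measurable_set1 (- t k))).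
have G0 k : ([set x | phi x = 0 /\ `|x - x0| < r] : set L) = tr k @^-1` G k.
  apply/seteqP; split=> x; rewrite /G /tr /= phi_shift opprD addrACA subrr addr0.
    by move=> [-> ?]; rewrite sub0r.
  by move=> [h ?]; split => //; lra.
set g := leb R n _.
have gG k : (g <= (6 ^+ n.+1)%:E * leb R n (G k))%E.
  have l1 (x y : 'rV[R]_n.+1) : `|itr k x - itr k y| <= 1 * `|x - y|.
    by rewrite /itr opprB addrA subrK mul1r.
  have c1 : cancel (tr k) (itr k) by move=> x; exact: addrK.
  have c2 : cancel (itr k) (tr k) by move=> x; exact: subrK.
  rewrite /g (G0 k) -[X in (X ^+ _)%:E]mulr1.
  exact: (bilipschitz_preimage_le ltr01 c1 c2 l1).
have tG : trivIset setT G.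
  apply/trivIsetP => i j _ _ ij; apply/seteqP; split => // x [[/= xi _] [/= xj _]].
  have : t i = t j by apply: oppr_inj; rewrite -xi -xj.
  by rewrite /t => /invr_inj/eqP; rewrite eqr_nat eqSS (negbTE ij).
pose F := leb R n [set x : 'rV[R]_n.+1 | (`|x - x0| < r + `|nu|)%R].
have Foo : (F < +oo)%E by exact: leb_ball_lty.
have GF : (\sum_(k <oo) leb R n (G k) <= F)%E.
  rewrite -measure_semi_bigcup//; last exact: bigcupT_measurable.
  apply: le_lebesgue_outer => x [k _ [_ /= xk]].
  rewrite -(subrK (t k *: nu) (x - x0)); apply: le_lt_trans (ler_normD _ _) _.
  apply: ltr_leD; first by rewrite -addrA -opprD.
  by rewrite normrZ ler_piMl//; have /andP[t0 t1] := t01 k; rewrite ger0_norm// ltW.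
have g0 : (0 <= g)%E by exact: measure_ge0.
have C0 : 0 < 6 ^+ n.+1 :> R by rewrite exprn_gt0.
(* A bound on every multiple of [g] by one finite number; this forces [g] to be 0. *)
have mgF m : (m%:R%:E * g <= (6 ^+ n.+1)%:E * F)%E.
  apply: (@le_trans _ _ ((6 ^+ n.+1)%:E * \sum_(0 <= k < m) leb R n (G k))%E); last first.
    rewrite lee_wpmul2l ?lee_fin ?(ltW C0)//; apply: le_trans GF.
    by apply: nneseries_lim_ge => k _ _; exact: measure_ge0.
  rewrite ge0_sume_distrr; last by move=> k _; exact: measure_ge0.
  apply: (@le_trans _ _ (\sum_(0 <= k < m) g)%E); last by apply: lee_sum => k _.
  elim: m => [|m IH]; first by rewrite big_geq// mul0e.
  by rewrite big_nat_recr//= -natr1 EFinD ge0_muleDl// mul1e leeD2r.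
have F0 : (0 <= F)%E by exact: measure_ge0.
have Ffin : F \is a fin_num by rewrite ge0_fin_numE.
move: g0 mgF; clear gG.
rewrite -(fineK Ffin); move: (fine F) => f; clearbody g.
case: g => [g| |//]; last first.
  by move=> _ /(_ 1%N); rewrite mul1e -EFinM leye_eq.
rewrite lee_fin => g0 H; congr EFin; apply/eqP; rewrite eq_le g0 andbT leNgt.
apply/negP => gp.
have := H (Num.truncn (6 ^+ n.+1 * f / g)).+1.
rewrite -EFinM lee_fin -ler_pdivlMr// leNgt => /negP; apply.
exact: truncnS_gt.
Qed.

End null_graph.

(** What gluing requires of a cutoff: the product of [psi] with any function extends from [D] with
    controlled energy, the constant being chosen before [u]. The Lipschitz condition is recorded so
    that 1 - psi can serve as a multiplier. *)
Definition local_extension (R : realType) (n : nat) (kappa : 'rV[R]_n.+1 -> \bar R)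
    (p : R) (D : set (leb_space R n)) (psi : 'rV[R]_n.+1 -> R) : Prop :=
  let E := energy (leb R n) (fun x y => kappa ((x : 'rV[R]_n.+1) - y)%R) p in
  [/\ forall x, 0 <= psi x <= 1,
      exists c, forall x y, `|psi x - psi y| <= c * `|x - y| &
      exists C : R, 0 < C /\ forall u : leb_space R n -> R, measurable_fun setT u ->
        exists w : leb_space R n -> R, [/\ measurable_fun setT w,
          forall x, D x -> w x = psi x * u x &
          (E setT w <= C%:E * E D u)%E]].

Lemma lee_scaled_sum_trans (R : realType) (t C1 C3 C2 : R) (a e1 e3 e2 e : \bar R) :
  0 <= t -> 0 <= C1 -> 0 <= C3 -> 0 <= C2 -> (0 <= e)%E ->
  (a <= t%:E * (e1 + e3))%E -> (e1 <= C1%:E * e)%E -> (e3 <= C3%:E * e2)%E ->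
  (e2 <= C2%:E * e)%E -> (a <= (t * (C1 + C3 * C2))%:E * e)%E.
Proof.
move=> t0 C10 C30 C20 e0 ae e1e e3e e2e; apply: le_trans ae _.
rewrite EFinM -muleA lee_wpmul2l ?lee_fin//.
rewrite EFinD ge0_muleDl ?lee_fin ?mulr_ge0//; apply: leeD => //.
apply: le_trans e3e _.
by rewrite EFinM -muleA lee_wpmul2l.
Qed.

Section local_extensions.
Context (R : realType) (n : nat).
Local Notation V := 'rV[R]_n.+1.
Local Notation L := (leb_space R n).
Context (p : R) (p_ge1 : 1 <= p) (kappa : V -> \bar R)
  (kappa_ge0 : forall x, (0 <= kappa x)%E)
  (kappa_opp : forall x, kappa (- x) = kappa x)
  (mkappa : measurable_fun [set: L] (kappa : L -> \bar R))
  (mkappa_sub : measurable_fun [set: L * L] (fun z => kappa ((z.1 : V) - z.2)))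
  (kappa_int : (\int[leb R n]_z (kappa z * (trunc_pow p z)%:E) < +oo)%E)
  (kappa_comparable : forall c : R, exists2 delta, 0 < delta & exists2 C, 0 < C &
    forall z z' : V, `|z| < delta -> `|z'| <= c * `|z| ->
    (kappa z <= C%:E * kappa z')%E).

Let piece := extension_piece p_ge1 kappa_ge0 kappa_opp mkappa mkappa_sub
  kappa_int kappa_comparable.

Let leb0 : leb R n set0 = 0%E. Proof. exact: lebesgue_outer0. Qed.
Let mid : measurable_fun [set: L] (id : L -> L). Proof. exact: measurable_id. Qed.
Let id_le (A : set L) : measurable A -> (leb R n (id @^-1` A) <= 1%:E * leb R n A)%E.
Proof. by rewrite mul1e. Qed.
Let id_lip (B : set L) (x y : V) : B x -> B y -> `|id x - id y| <= 1 * `|x - y|.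
Proof. by rewrite mul1r. Qed.

Lemma local_extension0 (D : set L) : local_extension kappa p D (fun=> 0).
Proof.
have p0 : p != 0 by rewrite gt_eqF// (lt_le_trans ltr01).
split; first by move=> x; rewrite lexx ler01.
  by exists 0 => x y; rewrite subrr normr0 mul0r.
exists 1; split; first exact: ltr01.
move=> u um; exists (fun=> 0); split; first exact: measurable_cst.
  by move=> x _; rewrite mul0r.
apply: (@le_trans _ _ 0%E).
  rewrite /energy /Lp_mass !integral0_eq ?adde0//.
    by move=> z _; rewrite /gagliardo subrr normr0 powR0// mulr0 mul0e.
  by move=> x _; rewrite normr0 powR0// mulr0.
rewrite mul1e /energy adde_ge0//; first exact: Lp_mass_ge0.
by apply: integral_ge0 => z _; exact: gagliardo_ge0.
Qed.

(** If [w1] and [w2] extend psi1 u and psi2 u, then w1 + (1 - psi1) w2 works for the combined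
    cutoff. *)
Lemma local_extension_glue (D : set L) (psi1 psi2 : V -> R) :
  local_extension kappa p D psi1 -> local_extension kappa p D psi2 ->
  local_extension kappa p D (fun x => psi1 x + (1 - psi1 x) * psi2 x).
Proof.
move=> [i1 [c1 l1] [C1 [C10 H1]]] [i2 [c2 l2] [C2 [C20 H2]]].
have i1c x : 0 <= 1 - psi1 x <= 1.
  by have /andP[? ?] := i1 x; apply/andP; split; lra.
have l1c x y : `|(1 - psi1 x) - (1 - psi1 y)| <= c1 * `|x - y|.
  have -> : (1 - psi1 x) - (1 - psi1 y) = - (psi1 x - psi1 y) by ring.
  by rewrite normrN.
(* Multiplication by the Lipschitz function 1 - psi1 is a local piece whose fold is the identity of
   the whole space. *)
have [C [C0 HC]] : exists C : R, 0 < C /\ forall u : L -> R, measurable_fun setT u ->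
    measurable_fun setT (fun x : L => (1 - psi1 x) * pullback setT id u x) /\
    (energy (leb R n) (fun x y => kappa ((x : V) - y)%R) p setT
       (fun x => (1 - psi1 x) * pullback setT id u x)%R <=
      C%:E * energy (leb R n) (fun x y => kappa ((x : V) - y)%R) p setT u)%E.
  apply: (piece measurableT measurableT measurable0 leb0 mid ltr01 id_le _ (@id_lip setT) i1c l1c).
  - by [].
  - by move=> x /(_ I).
split.
- move=> x; have /andP[a0 a1] := i1 x; have /andP[b0 b1] := i2 x.
  apply/andP; split; first by rewrite addr_ge0 ?mulr_ge0 ?subr_ge0.
  have : (1 - psi1 x) * psi2 x <= 1 - psi1 x by rewrite ler_piMr ?subr_ge0.
  lra.
- exists (c1 + c1 + c2) => x y.
  have -> : psi1 x + (1 - psi1 x) * psi2 x - (psi1 y + (1 - psi1 y) * psi2 y) =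
    (psi1 x - psi1 y) - (psi1 x - psi1 y) * psi2 x + (1 - psi1 y) * (psi2 x - psi2 y)
    by ring.
  apply: le_trans (ler_normD _ _) _; rewrite [leRHS]mulrDl; apply: lerD.
    apply: le_trans (ler_normB _ _) _; rewrite [leRHS]mulrDl; apply: lerD => //.
    rewrite normrM; apply: le_trans (l1 x y); rewrite ler_piMr//.
    by have /andP[b0 b1] := i2 x; rewrite ger0_norm.
  rewrite normrM; apply: le_trans (l2 x y); rewrite ler_piMl//.
  by have /andP[b0 b1] := i1c y; rewrite ger0_norm.
exists (2 `^ p * (C1 + C * C2)); split.
  by rewrite mulr_gt0 ?powR_gt0// addr_gt0// mulr_gt0.
move=> u um.
have [w1 [mw1 w1E w1C]] := H1 u um; have [w2 [mw2 w2E w2C]] := H2 u um.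
have [mw3 w3C] := HC w2 mw2.
exists (fun x => w1 x + (1 - psi1 x) * pullback setT id w2 x); split.
- exact: (measurable_funD mw1 mw3).
- by move=> x Dx; rewrite /pullback indicT mul1r/= w1E// w2E//; ring.
apply: (lee_scaled_sum_trans _ (ltW C10) (ltW C0) (ltW C20) _ _ w1C w3C w2C).
- exact: powR_ge0.
- rewrite /energy adde_ge0//; first exact: Lp_mass_ge0.
  by apply: integral_ge0 => z _; exact: gagliardo_ge0.
exact: (@energy_add_le _ L R (leb R n) (fun x y => kappa ((x : V) - y)) p setT
  _ _ p_ge1 (fun x y => kappa_ge0 _) mkappa_sub measurableT mw1 mw3).
Qed.

(** The identity serves as fold, since the tent vanishes outside a ball contained in [D]. *)
Lemma local_extension_interior (D : set L) (x0 : V) (r : R) : 0 < r ->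
  measurable D -> (forall x : V, `|x - x0| < 2 * r -> D x) ->
  local_extension kappa p D (tent x0 r).
Proof.
move=> r0 mD rD.
pose B : set L := [set x : V | `|x - x0| < 2 * r].
have mB : measurable B by exact: measurable_row_ball.
have tB (x : V) : ~ B x -> tent x0 r x = 0.
  by move=> nBx; apply: tent_eq0 => //; rewrite leNgt; apply/negP.
have [C [C0 HC]] : exists C : R, 0 < C /\ forall u : L -> R, measurable_fun setT u ->
    measurable_fun setT (fun x : L => tent x0 r x * pullback B id u x) /\
    (energy (leb R n) (fun x y => kappa ((x : V) - y)%R) p setT
       (fun x => tent x0 r x * pullback B id u x)%R <=
      C%:E * energy (leb R n) (fun x y => kappa ((x : V) - y)%R) p D u)%E.
  apply: (piece mD mB measurable0 leb0 mid ltr01 id_le _ (@id_lip B) (tent_itv x0 r) (tent_lipschitz x0 r0)).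
  - by move=> x; exact: rD.
  - by move=> x nBx _; exact: tB.
split; first exact: tent_itv.
  by exists r^-1; exact: tent_lipschitz.
exists C; split => //.
move=> u um; have [mw wC] := HC u um.
exists (fun x : L => tent x0 r x * pullback B id u x); split; [exact: mw| |exact: wC].
move=> x Dx; rewrite /pullback; have [Bx|nBx] := pselect (B x).
  by rewrite indicE mem_set// mul1r.
by rewrite tB// !mul0r.
Qed.

Lemma local_extension_boundary (D : set L) (x0 : V) (r : R) (phi : V -> R) (nu : V) (c : R) :
  0 < r -> measurable D ->
  (forall x y, `|phi x - phi y| <= c * `|x - y|) ->
  (forall x t, phi (x + t *: nu) = phi x - t) ->
  phi x0 = 0 ->
  (forall x : V, `|x - x0| < r -> (D x <-> phi x < 0)) ->
  exists2 rho, 0 < rho & local_extension kappa p D (tent x0 rho).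
Proof.
move=> r0 mD phi_lip phi_shift phi0 Dphi.
have mphi := measurable_graph_fun phi_lip.
(* [T] reflects across the graph along [nu]: a Lipschitz involution that changes the sign of [phi].
   The fold [S] is [T] where phi > 0 and the identity elsewhere. *)
pose T (x : V) := x + (2 * phi x) *: nu.
pose S (x : V) := x + (2 * Num.max 0 (phi x)) *: nu.
pose k := 1 + 2 * `|c| * `|nu|.
have k1 : 1 <= k by rewrite lerDl !mulr_ge0.
have k0 : 0 < k := lt_le_trans ltr01 k1.
have cabs (x y : V) : c * `|x - y| <= `|c| * `|x - y|.
  by rewrite ler_wpM2r// ler_norm.
have lipk (f : V -> R) : (forall x y, `|f x - f y| <= `|c| * `|x - y|) ->
    forall x y, `|x + (2 * f x) *: nu - (y + (2 * f y) *: nu)| <= k * `|x - y|.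
  move=> fl x y; rewrite opprD addrACA -scalerBl -mulrBr /k [leRHS]mulrDl mul1r.
  apply: le_trans (ler_normD _ _) _; rewrite lerD2l normrZ normrM ger0_norm//.
  rewrite [leRHS]mulrAC ler_wpM2r// -mulrA ler_wpM2l//.
have lipT : forall x y, `|T x - T y| <= k * `|x - y|.
  exact: (lipk phi (fun x y => le_trans (phi_lip x y) (cabs x y))).
have lipS : forall x y, `|S x - S y| <= k * `|x - y|.
  apply: (lipk (fun x => Num.max 0 (phi x))) => x y; apply: le_trans (cabs x y); apply: le_trans (phi_lip x y).
  have : phi x - phi y <= `|phi x - phi y| by exact: ler_norm.
  have : phi y - phi x <= `|phi x - phi y| by rewrite distrC ler_norm.
  move: `|_| => s; rewrite ler_norml /Num.max.
  by repeat case: ifPn; rewrite -?leNgt => *; apply/andP; split; lra.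
have phiT x : phi (T x) = - phi x by rewrite /T phi_shift; ring.
have TT : cancel T T.
  by move=> x; rewrite {1}/T phiT /T -addrA -scalerDl mulrN subrr scale0r addr0.
have ST x : 0 < phi x -> S x = T x by move=> h; rewrite /S max_r// ltW.
have Sid x : phi x <= 0 -> S x = x by move=> h; rewrite /S max_l// mulr0 scale0r addr0.
pose P : set L := [set x | 0 < phi x].
have mP : measurable P.
  rewrite -[X in measurable X]setTI (_ : P = phi @^-1` `]0, +oo[%classic).
    exact: mphi.
  by apply/seteqP; split=> x; rewrite /P/= in_itv/= andbT.
have mT : measurable_fun [set: L] (T : L -> L) := bilipschitz_measurable k0 TT TT lipT lipT.
have SE (A : set L) : (S : L -> L) @^-1` A = ((T : L -> L) @^-1` A `&` P) `|` (A `\` P).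
  apply/seteqP; split=> x /=.
    have [px|px] := ltP 0 (phi x).
      by rewrite ST// => h; left.
    by rewrite Sid// => h; right; split => //; rewrite /P/= ltNge px.
  move=> [[h px]|[h /negP]]; first by rewrite ST.
  by rewrite -leNgt => px; rewrite Sid.
have mTA (A : set L) : measurable A -> measurable ((T : L -> L) @^-1` A).
  by move=> mA; rewrite -[X in measurable X]setTI; exact: mT.
have mS : measurable_fun [set: L] (S : L -> L).
  move=> _ A mA; rewrite setTI SE; apply: measurableU.
    by apply: measurableI => //; exact: mTA.
  exact: measurableD.
(* A preimage under [S] is part of the preimage under [T] together with part of the set itself; the
   latter accounts for the + 1. *)
pose M : R := (6 * k) ^+ n.+1 + 1.
have K0 : 0 <= (6 * k) ^+ n.+1 by rewrite exprn_ge0// mulr_ge0// ltW.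
have M0 : 0 < M by rewrite ltr_wpDl.
have SM (A : set L) : measurable A -> (leb R n ((S : L -> L) @^-1` A) <= M%:E * leb R n A)%E.
  move=> mA; rewrite SE.
  apply: le_trans (outer_measureU2 _ _ _) _.
  rewrite EFinD ge0_muleDl ?lee_fin// mul1e; apply: leeD.
    apply: le_trans (bilipschitz_preimage_le k0 TT TT lipT A).
    by apply: le_lebesgue_outer => x [].
  by apply: le_lebesgue_outer => x [].
(* [S] is [k]-Lipschitz and fixes [x0], so it maps the ball of radius 2 rho into the ball of radius
   [r] where the chart is valid. *)
pose rho := r / (2 * k).
have rho0 : 0 < rho by rewrite divr_gt0// mulr_gt0.
have rhok : 2 * rho * k = r by rewrite /rho; field; rewrite gt_eqF.
have rhor : 2 * rho <= r by rewrite -rhok ler_peMr// mulr_ge0// ltW.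
exists rho => //.
(* [S] fixes these points and none of them is in [D], so they must be removed from [B]. *)
pose Gam : set L := [set x : V | phi x = 0 /\ `|x - x0| < 2 * rho].
have Gam0 : leb R n Gam = 0%E by exact: (graph_null phi_lip phi_shift).
have mGam : measurable Gam by exact: lebesgue_null_measurable Gam0.
pose B : set L := [set x : V | `|x - x0| < 2 * rho] `\` Gam.
have mB : measurable B by apply: measurableD => //; exact: measurable_row_ball.
have tB (x : V) : ~ `|x - x0| < 2 * rho -> tent x0 rho x = 0.
  by move=> nBx; apply: tent_eq0 => //; rewrite leNgt; apply/negP.
have SB (x : L) : B x -> D (S x).
  move=> [/= xr nG].
  have Sx : `|S x - x0| < r.
    have -> : x0 = S x0 by rewrite Sid// phi0.
    by apply: le_lt_trans (lipS _ _) _; rewrite -rhok mulrC ltr_pM2r.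
  apply/(Dphi _ Sx); have [px|px] := ltP 0 (phi x).
    by rewrite ST// phiT oppr_lt0.
  rewrite Sid// lt_neqAle px andbT; apply/eqP => px0; exact: nG.
have [C [C0 HC]] : exists C : R, 0 < C /\ forall u : L -> R, measurable_fun setT u ->
    measurable_fun setT (fun x : L => tent x0 rho x * pullback B (S : L -> L) u x) /\
    (energy (leb R n) (fun x y => kappa ((x : V) - y)%R) p setT
       (fun x => tent x0 rho x * pullback B (S : L -> L) u x)%R <=
      C%:E * energy (leb R n) (fun x y => kappa ((x : V) - y)%R) p D u)%E.
  apply: (piece mD mB mGam Gam0 mS M0 SM SB _ (tent_itv x0 rho) (tent_lipschitz x0 rho0)).
  - by move=> x y _ _; exact: lipS.
  - move=> x nBx nGx; apply: tB => xr; exact: nBx.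
split; first exact: tent_itv.
  by exists rho^-1; exact: tent_lipschitz.
exists C; split => //.
move=> u um; have [mw wC] := HC u um.
exists (fun x : L => tent x0 rho x * pullback B (S : L -> L) u x).
split; [exact: mw| |exact: wC].
move=> x Dx; rewrite /pullback; have [xr|xr] := ltP `|(x : V) - x0| (2 * rho).
  have px : phi x < 0 by apply/(Dphi _ _).1 => //; exact: lt_le_trans rhor.
  rewrite indicE mem_set; first by rewrite mul1r Sid ?(ltW px).
  by split => // -[p0 _]; move: px; rewrite p0 ltxx.
by rewrite tB ?mul0r//; apply/negP; rewrite -leNgt.
Qed.

End local_extensions.

(** * Gluing *)

(** In the coordinates given by [Q], phi is g(x') - x_d, and [nu] is the last coordinate vector
    rotated back, so that moving along it changes x_d alone. *)
Lemma lipschitz_boundary_chart (R : realType) (n : nat) (Omega : set 'rV[R]_n.+1)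
    (x0 : 'rV[R]_n.+1) :
  open Omega -> lipschitz_boundary Omega -> closure Omega x0 -> ~ Omega x0 ->
  exists r phi nu (c : R), [/\ 0 < r,
    forall x y, `|phi x - phi y| <= c * `|x - y|,
    forall x t, phi (x + t *: nu) = phi x - t,
    phi x0 = 0 &
    forall x, `|x - x0| < r -> (Omega x <-> phi x < 0)].
Proof.
move=> oO lO clx0 nx0.
have [|r [Q [g [Lg [r0 QQ gL OQ]]]]] := lO x0.
  by split => // /interior_subset.
have QQ' : Q^T *m Q = 1%:M by exact: mulmx1C.
pose phi (x : 'rV[R]_n.+1) := g (col' ord_max (x *m Q)) - (x *m Q) 0 ord_max.
pose nu : 'rV[R]_n.+1 := delta_mx 0 ord_max *m Q^T.
pose s : R := Num.sqrt n.+1%:R.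
have s0 : 0 < s by rewrite sqrtr_gt0 ltr0n.
have phi_shift x t : phi (x + t *: nu) = phi x - t.
  rewrite /phi mulmxDl -scalemxAl /nu -mulmxA QQ' mulmx1.
  have -> : col' ord_max (x *m Q + t *: delta_mx 0 ord_max) = col' ord_max (x *m Q).
    apply/rowP => i; rewrite !mxE eqxx/= (_ : lift _ _ == _ = false) ?mulr0 ?addr0//.
    by apply/negbTE; rewrite eq_sym neq_lift.
  by rewrite !mxE !eqxx mulr1 opprD addrA.
have phi_lip x y : `|phi x - phi y| <= (`|Lg| + 1) * s * `|x - y|.
  have -> : phi x - phi y = (g (col' ord_max (x *m Q)) - g (col' ord_max (y *m Q))) -
      ((x - y) *m Q) 0 ord_max.
    by rewrite /phi mulmxBl !mxE; ring.
  have nxy : norm2 ((x - y) *m Q) <= s * `|x - y|.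
    by rewrite norm2_orthogonal//; exact: norm2_le_norm.
  apply: le_trans (ler_normB _ _) _; rewrite -mulrA mulrDl mul1r; apply: lerD.
    apply: le_trans (gL _ _) _.
    have -> : col' ord_max (x *m Q) - col' ord_max (y *m Q) = col' ord_max ((x - y) *m Q).
      by rewrite mulmxBl; apply/rowP => i; rewrite !mxE.
    apply: (@le_trans _ _ (`|Lg| * norm2 (col' ord_max ((x - y) *m Q)))).
      by rewrite ler_wpM2r ?norm2_ge0// ler_norm.
    by rewrite ler_wpM2l//; exact: le_trans (norm2_col' _ _) nxy.
  exact: le_trans (ler_coord_norm2 _ _) nxy.
(* The sup-norm ball of radius r / sqrt(d) lies in the Euclidean ball of radius [r]. *)
pose r' := r / s.
have r'0 : 0 < r' by rewrite divr_gt0.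
have Ophi x : `|x - x0| < r' -> (Omega x <-> phi x < 0).
  move=> xr; rewrite /phi subr_lt0; apply: OQ.
  apply: le_lt_trans (norm2_le_norm _) _.
  by rewrite mulrC -ltr_pdivlMr.
exists r', phi, nu, ((`|Lg| + 1) * s); split => //.
(* phi(x0) < 0 would put [x0] in Omega; phi(x0) > 0 would persist nearby and keep Omega away from a
   point of its closure. *)
apply/eqP; rewrite eq_le; apply/andP; split; last first.
  rewrite leNgt; apply/negP => p0; apply: nx0; apply/Ophi => //.
  by rewrite subrr normr0.
rewrite leNgt; apply/negP => p0.
have [|x [Ox]] := clx0 ([set x | 0 < phi x] `&` [set x | `|x - x0| < r']).
  apply: filterI.
    apply: open_nbhs_nbhs; split => //.
    rewrite (_ : [set x | 0 < phi x] = phi @^-1` `]0, +oo[%classic).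
      apply: open_comp => [x _|]; last exact: interval_open.
      exact: (lipschitz_map_continuous phi_lip).
    by apply/seteqP; split=> x; rewrite /= in_itv/= andbT.
  apply/nbhs_ballP; exists r' => //= y; rewrite -ball_normE/=.
  by rewrite distrC.
by move=> [/= px xr]; move: Ox; rewrite Ophi// => /(lt_trans px); rewrite ltxx.
Qed.

Section extension.
Context (R : realType) (n : nat).
Local Notation V := 'rV[R]_n.+1.
Local Notation L := (leb_space R n).
Context (p : R) (p_ge1 : 1 <= p) (kappa : V -> \bar R)
  (kappa_ge0 : forall x, (0 <= kappa x)%E)
  (kappa_opp : forall x, kappa (- x) = kappa x)
  (mkappa : measurable_fun [set: L] (kappa : L -> \bar R))
  (mkappa_sub : measurable_fun [set: L * L] (fun z => kappa ((z.1 : V) - z.2)))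
  (kappa_int : (\int[leb R n]_z (kappa z * (trunc_pow p z)%:E) < +oo)%E)
  (kappa_comparable : forall c : R, exists2 delta, 0 < delta & exists2 C, 0 < C &
    forall z z' : V, `|z| < delta -> `|z'| <= c * `|z| ->
    (kappa z <= C%:E * kappa z')%E).

Lemma local_extension_global (Omega : set V) :
  bounded_set Omega -> open Omega -> lipschitz_boundary Omega ->
  exists2 psi, local_extension kappa p Omega psi & forall x, Omega x -> psi x = 1.
Proof.
move=> bO oO lO; have mO := open_leb_measurable oO.
have loc (x0 : V) : exists rho, closure Omega x0 ->
    0 < rho /\ local_extension kappa p Omega (tent x0 rho).
  (* Radius 0 is a dummy value for points outside the closure. *)
  have [clx0|] := pselect (closure Omega x0); last by exists 0.
  have [Ox0|nOx0] := pselect (Omega x0).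
    have /nbhs_ballP[e /= e0 eO] : nbhs x0 Omega by exact: open_nbhs_nbhs.
    exists (e / 2) => _; split; first by rewrite divr_gt0.
    apply: (local_extension_interior p_ge1 kappa_ge0 kappa_opp mkappa mkappa_sub kappa_int kappa_comparable).
    - by rewrite divr_gt0.
    - exact: mO.
    - move=> x xe; apply: eO; rewrite -ball_normE/= distrC.
      by move: xe; rewrite mulrC divfK.
  have [r [phi [nu [c [r0 h1 h2 h3 h4]]]]] := lipschitz_boundary_chart oO lO clx0 nOx0.
  have [rho rho0 H] := local_extension_boundary p_ge1 kappa_ge0 kappa_opp mkappa
    mkappa_sub kappa_int kappa_comparable r0 mO h1 h2 h3 h4.
  by exists rho => _.
have [rho rhoP] := choice loc.
have cO : compact (closure Omega).
  apply: bounded_closed_compact; last exact: closed_closure.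
  have [M [Mr HM]] := bO; exists M; split => // x Mx y cly.
  (* Half of the gap x - M is spent on approximating [y] by a point of Omega. *)
  have e0 : 0 < (x - M) / 2 by rewrite divr_gt0// subr_gt0.
  have [z [Oz]] := cly (ball y ((x - M) / 2)) (nbhsx_ballx _ _ e0).
  rewrite -ball_normE/= => yz.
  have zM : `|z| <= M + (x - M) / 2 by apply: HM Oz; rewrite ltrDl.
  rewrite -(subrK z y); apply: le_trans (ler_normD _ _) _; lra.
have oB (x : V) : closure Omega x -> open (ball x (rho x)).
  by move=> clx; apply: ball_open; exact: (rhoP x clx).1.
have Ocov : closure Omega `<=` cover (closure Omega) (fun x => ball x (rho x)).
  by move=> x clx; exists x => //; apply: ballxx; exact: (rhoP x clx).1.
move: cO; rewrite compact_cover => /(_ V (closure Omega) _ oB Ocov)[s sO Os].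
have /finite_seqP[l sl] := finite_fset s; rewrite sl in Os.
(* Induction on the centres, from the cutoff 0: a glued cutoff equals 1 wherever the new tent or the
   previous cutoff does. *)
have [psi [psiE psi1]] : exists psi, local_extension kappa p Omega psi /\
    forall x0 x, x0 \in l -> ball x0 (rho x0) x -> psi x = 1.
  have : {in l, forall x, closure Omega x}.
    move=> x xl; apply/set_mem/sO.
    by have : [set` l] x by []; rewrite -sl.
  elim: (l) => [|x0 t IH] tO.
    by exists (fun=> 0); split => //; exact: (local_extension0 p_ge1 kappa_ge0).
  have [|psi [psiE psi1]] := IH; first by move=> x xt; apply: tO; rewrite inE xt orbT.
  have [rho0 H] := rhoP x0 (tO x0 (mem_head _ _)).
  exists (fun x => tent x0 (rho x0) x + (1 - tent x0 (rho x0) x) * psi x); split.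
    exact: (local_extension_glue p_ge1 kappa_ge0 kappa_opp mkappa mkappa_sub kappa_int kappa_comparable).
  move=> y x; rewrite inE => /orP[/eqP ->|yt] yx.
    rewrite tent_eq1; first by rewrite subrr mul0r addr0.
      exact: rho0.
    by move: yx; rewrite -ball_normE/= distrC => /ltW.
  by rewrite (psi1 y x)// mulr1 addrC subrK.
exists psi => // x Ox.
have [y ys yx] := Os x (subset_closure Ox).
exact: (psi1 y x).
Qed.

End extension.

(** * The extension theorem *)

(** Each term on the left is at most (C (A + B))^s, hence at most C^s 2^s (A^s + B^s); the leading 2
    counts the two terms. Used with s = 1 / p to return from energies to norms. *)
Lemma poweR_sum_le (R : realType) (s C : R) (A B A' B' : \bar R) : 0 < s -> 0 <= C ->
  (0 <= A)%E -> (0 <= B)%E -> (0 <= A')%E -> (0 <= B')%E ->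
  (A < +oo)%E -> (B < +oo)%E -> (A' + B' <= C%:E * (A + B))%E ->
  ((A' `^ s) + (B' `^ s) <= (2 * C `^ s * 2 `^ s)%:E * (A `^ s + B `^ s))%E.
Proof.
move=> s0 C0.
case: A => [a| |]//; case: B => [b| |]// a0 b0.
case: A' => [a'| |]//; case: B' => [b'| |]// a'0 b'0 _ _.
rewrite !lee_fin in a0 b0 a'0 b'0 *.
move=> H.
have step t : 0 <= t -> t <= a' + b' -> t `^ s <= C `^ s * 2 `^ s * (a `^ s + b `^ s).
  move=> t0 tH; apply: (@le_trans _ _ ((C * (a + b)) `^ s)).
    apply: ge0_ler_powR; rewrite ?nnegrE ?mulr_ge0 ?addr_ge0 ?(ltW s0)//.
    exact: le_trans tH H.
  rewrite powRM ?addr_ge0// -mulrA ler_wpM2l ?powR_ge0//.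
  exact: powR_addr_le (ltW s0) a0 b0.
have h1 := step a' a'0 _; have h2 := step b' b'0 _.
rewrite -!mulrA mulr_natl mulr2n !mulrA.
by apply: lerD; [apply: h1; rewrite lerDl|apply: h2; rewrite lerDr].
Qed.

(** Exchange of kernels: on Omega [kappa] gives way to [K] at the cost of 1 / c0, while on the whole
    space [K] is below [kappa]. *)
Lemma lee_scaled_sum (R : realType) (c0 C1 : R) (A X A' X' G G' : \bar R) :
  0 < c0 -> c0 <= 1 -> 0 < C1 -> (0 <= A)%E -> (0 <= X)%E -> (0 <= G)%E ->
  (c0%:E * G <= X)%E -> (X' <= G')%E -> (A' + G' <= C1%:E * (A + G))%E ->
  (A' + X' <= (C1 / c0)%:E * (A + X))%E.
Proof.
move=> c00 c01 C10 A0 X0 G0 GX XG H.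
apply: (le_trans (leeD2l A' XG)); apply: le_trans H _.
rewrite EFinM -muleA; apply: lee_wpmul2l; first by rewrite lee_fin ltW.
rewrite ge0_muleDr//; apply: leeD; last by rewrite lee_pdivlMl.
by rewrite -[leLHS]mul1e; apply: lee_wpmul2r => //; rewrite lee_fin invf_ge1.
Qed.

Section norms_as_integrals.
Context (R : realType) (n : nat) (p : R) (p_ge1 : 1 <= p).
Local Notation V := 'rV[R]_n.+1.
Local Notation L := (leb_space R n).
Implicit Types (D : set V) (u : V -> R) (K kappa : V -> \bar R).

Let p_neq0 : p != 0. Proof. by rewrite gt_eqF// (lt_le_trans ltr01). Qed.

Lemma Lp_normE D u :
  Lp_norm p D u = ((Lp_mass (leb R n) p (D : set L) (u \_ D)) `^ p^-1)%E.
Proof.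
rewrite /Lp_norm unlock/=; congr (_ `^ _)%E; apply: eq_integral => x _ /=.
rewrite indicE; congr EFin.
have [xD|xD] := boolP (x \in D); first by rewrite mul1r.
by rewrite patchE (negbTE xD) normr0 powR0// mul0r.
Qed.

(** Tonelli is applied on the [kappa] side, whose integrand is measurable in the pair, in the order
    of integration of the right-hand side; the two iterated integrals are then compared
    pointwise. *)
Lemma gagliardo_le_double_integral D u K kappa (c0 : R) : 0 < c0 ->
  measurable (D : set L) -> measurable_fun (D : set L) (u : L -> R) ->
  measurable_fun [set: L * L] (fun z => kappa ((z.1 : V) - z.2)) ->
  (forall x, (0 <= kappa x)%E) -> (forall x, (c0%:E * kappa x <= K x)%E) ->
  (c0%:E * \int[leb R n \x leb R n]_z
     gagliardo (fun x y : L => kappa ((x : V) - y)%R) p (D : set L) (u \_ D) z <=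
   \int[leb R n]_(y in D) \int[leb R n]_(x in D)
     ((`|u x - u y| `^ p)%:E * K ((x : V) - y)%R))%E.
Proof.
move=> c00 mD mu mk k0 kK.
have K0 x : (0 <= K x)%E.
  by apply: le_trans (kK x); rewrite mule_ge0// lee_fin ltW.
have mu0 : measurable_fun [set: L] (u \_ D : L -> R) by exact/(measurable_restrictT _ _).1.
pose G := gagliardo (fun x y : L => kappa ((x : V) - y)%R) p (D : set L) (u \_ D).
have G0 z : (0 <= G z)%E by exact: gagliardo_ge0.
have mG : measurable_fun setT G.
  exact: (@measurable_gagliardo _ L R p (fun x y : L => kappa ((x : V) - y)%R) mk D (u \_ D) mD mu0).
have c0E : (0 <= c0%:E)%E by rewrite lee_fin ltW.
rewrite -[X in (_ * X <= _)%E]/(\int[leb R n \x leb R n]_z G z)%E.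
rewrite (fubini_tonelli2 G mG G0).
have mI := @measurable_fun_fubini_tonelli_G _ _ L L R (leb R n) G mG G0.
have I0 y : (0 <= fubini_G (leb R n) G y)%E by apply: integral_ge0 => x _; exact: G0.
rewrite -(@ge0_integralZl _ _ _ (leb R n) setT measurableT _ mI c0%:E (fun y _ => I0 y) c0E).
rewrite [leRHS]integral_mkcond; apply: le_integral_nonmeasurable => y _.
  by rewrite mule_ge0.
have mGy : measurable_fun [set: L] (fun x => G (x, y)) by exact: (measurable_fun_pair1 y mG).
rewrite /fubini_G -(@ge0_integralZl _ _ _ (leb R n) setT measurableT _ mGy c0%:E (fun x _ => G0 _) c0E).
have [yD|yD] := boolP (y \in D); last first.
  rewrite patchE (negbTE yD) integral0_eq// => x _.
  by rewrite /G /gagliardo/= [X in _ * X * _]indicE (negbTE yD) mulr0 mul0r mul0e mule0.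
rewrite patchE yD [leRHS]integral_mkcond; apply: le_integral_nonmeasurable => x _.
  by rewrite mule_ge0.
rewrite [leRHS]patchE; have [xD|xD] := boolP (x \in D); last first.
  by rewrite /G /gagliardo/= [X in X * _ * _]indicE (negbTE xD) !mul0r mul0e mule0.
rewrite /G /gagliardo/= !indicE xD yD !mul1r !patchE xD yD muleCA.
by apply: lee_wpmul2l => //; rewrite lee_fin powR_ge0.
Qed.

Lemma double_integral_le_gagliardo u K kappa :
  measurable_fun [set: L] (u : L -> R) ->
  measurable_fun [set: L * L] (fun z => kappa ((z.1 : V) - z.2)) ->
  (forall x, (0 <= K x)%E) -> (forall x, (K x <= kappa x)%E) ->
  (\int[leb R n]_(y in [set: V]) \int[leb R n]_(x in [set: V])
     ((`|u x - u y| `^ p)%:E * K ((x : V) - y)%R) <=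
  \int[leb R n \x leb R n]_z
     gagliardo (fun x y : L => kappa ((x : V) - y)%R) p setT u z)%E.
Proof.
move=> mu mk K0 Kk.
have k0 x : (0 <= kappa x)%E by exact: le_trans (Kk x).
pose G := gagliardo (fun x y : L => kappa ((x : V) - y)%R) p setT u.
have G0 z : (0 <= G z)%E by exact: gagliardo_ge0.
have mG : measurable_fun setT G.
  exact: (@measurable_gagliardo _ L R p (fun x y : L => kappa ((x : V) - y)%R) mk setT u measurableT mu).
rewrite -[X in (_ <= X)%E]/(\int[leb R n \x leb R n]_z G z)%E.
rewrite (fubini_tonelli2 G mG G0).
apply: le_integral_nonmeasurable => y _.
  by apply: integral_ge0 => x _; rewrite mule_ge0// lee_fin powR_ge0.
apply: le_integral_nonmeasurable => x _; first by rewrite mule_ge0// lee_fin powR_ge0.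
rewrite /G /gagliardo/= !indicT !mul1r.
by apply: lee_wpmul2l => //; rewrite lee_fin powR_ge0.
Qed.

End norms_as_integrals.

Theorem theorem4p5 (R : realType) (n : nat) (p : R) (hp : 1 <= p)
    (Omega : set 'rV[R]_n.+1) (bounded_Omega : bounded_set Omega)
    (open_Omega : open Omega) (lip_Omega : lipschitz_boundary Omega)
    (N : 'rV[R]_n.+1 -> R) (norm_N : is_norm N)
    (K : 'rV[R]_n.+1 -> \bar R) (kernel_K : is_kernel K)
    (c0 : R) (c0_range : 0 < c0 <= 1)
    (K_decr : forall x y, N x <= N y -> (c0%:E * K y <= K x)%E)
    (CD : R) (CD_gt0 : 0 < CD)
    (K_int : (\int[leb R n]_z
                (K z * (Num.min 1 (norm2 z `^ p))%:E) < +oo)%E) :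
  exists C : R, 0 < C /\
    forall D : R, 0 < D ->
    (forall x y, N y = 2 * N x -> N x <= D -> (K x <= CD%:E * K y)%E) ->
    forall u, WKp_space K p Omega u ->
    exists u' : 'rV[R]_n.+1 -> R,
      [/\ WKp_space K p [set: 'rV[R]_n.+1] u',
          forall x, Omega x -> u' x = u x &
          (WKp_norm K p [set: 'rV[R]_n.+1] u' <=
             C%:E * WKp_norm K p Omega u)%E].
Proof.
(* [C] must be chosen before [D]. If doubling holds with some radius [D1], the constant built from
   [D1] serves every [D]; otherwise no [D] satisfies the doubling condition. *)
have [[D1 [D10 Kdbl]]|noD] := pselect (exists D1 : R, 0 < D1 /\
    (forall x y, N y = 2 * N x -> N x <= D1 -> (K x <= CD%:E * K y)%E)); last first.
  by exists 1; split => // D D0 KD; exfalso; apply: noD; exists D.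
have [K_ge0 _ _] := kernel_K.
have /andP[c00 c01] := c0_range.
have p0 : 0 < p := lt_le_trans ltr01 hp.
set L := leb_space R n; set V := 'rV[R]_n.+1.
pose kappa := kernel_hull N K.
have k0 : forall x, (0 <= kappa x)%E := kernel_hull_ge0 N K_ge0.
have Kk : forall x, (K x <= kappa x)%E := kernel_le_hull N K.
have kK x : (c0%:E * kappa x <= K x)%E.
  by rewrite -lee_pdivlMl//; exact: kernel_hull_le.
have mk2 := measurable_kernel_hull_sub norm_N K.
have kcomp := kernel_hull_comparable norm_N c00 K_decr CD_gt0 D10 Kdbl.
have kint := kernel_hull_integral_lty norm_N K_ge0 c00 K_decr hp K_int.
have [psi [_ _ [C1 [C10 HC]]] psi1] := local_extension_global hp k0
  (kernel_hull_opp norm_N K) (measurable_kernel_hull norm_N K) mk2 kint kcomp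
  bounded_Omega open_Omega lip_Omega.
have mO := open_leb_measurable open_Omega.
pose C2 := C1 / c0.
have C20 : 0 < C2 by rewrite divr_gt0.
exists (2 * C2 `^ p^-1 * 2 `^ p^-1); split.
  by rewrite !mulr_gt0 ?powR_gt0.
move=> _ _ _ u [[mu uoo] soo].
(* The values of [u] outside Omega are arbitrary; extended by 0 it becomes measurable on the whole
   space, as the local extensions require. *)
have mu0 : measurable_fun [set: L] (u \_ Omega : L -> R) by exact/(measurable_restrictT _ _).1.
have [w [mw wE wC]] := HC _ mu0.
have wu x : Omega x -> w x = u x.
  by move=> Ox; rewrite wE// psi1// mul1r patchE mem_set.
set A := Lp_mass (leb R n) p (Omega : set L) (u \_ Omega).
set A' := Lp_mass (leb R n) p setT w.
pose X := (\int[leb R n]_(y in Omega) \int[leb R n]_(x in Omega)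
     ((`|u x - u y| `^ p)%:E * K ((x : V) - y)%R))%E.
pose X' := (\int[leb R n]_(y in [set: V]) \int[leb R n]_(x in [set: V])
     ((`|w x - w y| `^ p)%:E * K ((x : V) - y)%R))%E.
have A0 : (0 <= A)%E by exact: Lp_mass_ge0.
have A'0 : (0 <= A')%E by exact: Lp_mass_ge0.
have dint0 (S : set V) (v : V -> R) : (0 <= \int[leb R n]_(y in S) \int[leb R n]_(x in S)
     ((`|v x - v y| `^ p)%:E * K ((x : V) - y)%R))%E.
  apply: integral_ge0 => y _; apply: integral_ge0 => x _.
  by rewrite mule_ge0// lee_fin powR_ge0.
have X0 : (0 <= X)%E := dint0 Omega u.
have X'0 : (0 <= X')%E := dint0 setT w.
have pV : 0 < p^-1 by rewrite invr_gt0.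
have Lu : Lp_norm p Omega u = (A `^ p^-1)%E := Lp_normE hp Omega u.
have Lw : Lp_norm p [set: V] w = (A' `^ p^-1)%E.
  by have := Lp_normE hp [set: V] w; rewrite patch_setT.
have Aoo : (A < +oo)%E by apply: (lty_poweRy (lt0r_neq0 pV)); rewrite -Lu.
have Xoo : (X < +oo)%E by exact: (lty_poweRy (lt0r_neq0 pV)).
have main : (A' + X' <= C2%:E * (A + X))%E.
  have g1 := gagliardo_le_double_integral p c00 mO mu mk2 k0 kK.
  have g2 := double_integral_le_gagliardo p mw mk2 K_ge0 Kk.
  have G0 : (0 <= \int[leb R n \x leb R n]_z
     gagliardo (fun x y : L => kappa ((x : V) - y)%R) p (Omega : set L) (u \_ Omega) z)%E.
    by apply: integral_ge0 => z _; exact: gagliardo_ge0.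
  exact: (lee_scaled_sum c00 c01 C10 A0 X0 G0 g1 g2 wC).
have fin : (A' + X' < +oo)%E.
  apply: le_lt_trans main _; rewrite lte_mul_pinfty ?lee_fin ?(ltW C20)//.
  exact: lte_add_pinfty.
have A'oo : (A' < +oo)%E by apply: le_lt_trans fin; rewrite leeDl.
have X'oo : (X' < +oo)%E by apply: le_lt_trans fin; rewrite leeDr.
have Su : WKp_seminorm K p Omega u = (X `^ p^-1)%E := erefl.
have Sw : WKp_seminorm K p [set: V] w = (X' `^ p^-1)%E := erefl.
clearbody A A' X X'.
exists w; split; [split; [split|]|exact: wu|].
- exact: mw.
- by rewrite Lw; exact: poweR_lty.
- by rewrite Sw; exact: poweR_lty.
rewrite /WKp_norm Lu Lw Su Sw.
exact: (poweR_sum_le pV (ltW C20) A0 X0 A'0 X'0 Aoo Xoo main).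
Qed.
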